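(* Let $(\Omega,\mathcal H,\mathbb E)$ be a sub-linear expectation space with $\mathbb E$ countably sub-additive. Let $l$ be a function slowly varying at infinity, and let $\{a_i,-\infty<i<\infty\}$ be a sequence of real numbers with $\sum_{i=-\infty}^{\infty}|a_i|<\infty$. Let $\{Y_i,-\infty<i<\infty\}\subset\mathcal H$ be a sequence of negatively dependent random variables, identically distributed as a random variable $Y\in\mathcal H$, with $\mathbb E(Y_i)=\mathbb E(-Y_i)=0$ for all $i$, and let $X_n=\sum_{i=-\infty}^{\infty}a_iY_{i+n}$, $n\ge1$, be the moving average process generated by $\{Y_i\}$. Let $\{g(n),n\ge1\}$ and $\{f(n),n\ge1\}$ be two sequences of positive constants with $f(n)\uparrow\infty$, and let $\{\Psi_n(t),n\ge1\}$ be a sequence of even and nonnegative functions on $\mathbb R$ such that $\Psi_n(t)>0$ for each $n\ge1$ and $t>0$. Suppose that for some $1\le p<q<2$ and every $n\ge 1$, $$\frac{\Psi_n(t)}{|t|^p}\uparrow\quad\text{and}\quad\frac{\Psi_n(t)}{|t|^q}\downarrow\qquad\text{as } |t|\uparrow,$$ and that for any integer $j\ge0$, $$\sum_{n=1}^{\infty}g(n)l(n)\sum_{i=j+1}^{j+n}\frac{C_{\mathbb V}(\Psi_i(Y_i))}{\Psi_i(f(n))}<\infty\quad\text{and}\quad\sum_{i=j+1}^{j+n}\frac{C_{\mathbb V}(\Psi_i(Y_i))}{\Psi_i(f(n))}\to0\ \text{ as } n\to\infty.$$ Then for all $\varepsilon>0$, $$\sum_{n=1}^{\infty}g(n)l(n)\,\mathbb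 V\left\{\max_{1\le k\le n}\left|\sum_{j=1}^{k}X_j\right|>\varepsilon f(n)\right\}<\infty.$$
   Context: Notation: $\uparrow$ and $\downarrow$ denote monotone increase and monotone decrease, and $I_A$ is the indicator of $A$. Sub-linear expectation space. $(\Omega,\mathcal F)$ is a measurable space. $C_{l,Lip}(\mathbb R^n)$ is the linear space of functions $\varphi:\mathbb R^n\to\mathbb R$ satisfying $|\varphi(\mathbf x)-\varphi(\mathbf y)|\le C(1+|\mathbf x|^m+|\mathbf y|^m)|\mathbf x-\mathbf y|$ for all $\mathbf x,\mathbf y\in\mathbb R^n$, for some $C>0$, $m\in\mathbb N$ depending on $\varphi$. $\mathcal H$ is a set of random variables on $(\Omega,\mathcal F)$ such that $X_1,\dots,X_n\in\mathcal H$ implies $\varphi(X_1,\dots,X_n)\in\mathcal H$ for each $\varphi\in C_{l,Lip}(\mathbb R^n)$. A sub-linear expectation is a functional $\mathbb E:\mathcal H\to[-\infty,\infty]$ such that for all $X,Y\in\mathcal H$: (a) $X\ge Y$ implies $\mathbb E[X]\ge\mathbb E[Y]$; (b) $\mathbb E[c]=c$ for $c\in\mathbb R$; (c) $\mathbb E[\lambda X]=\lambda\mathbb E[X]$ for $\lambda\ge0$; (d) $\mathbb E[X+Y]\le\mathbb E[X]+\mathbb E[Y]$ whenever $\mathbb E[X]+\mathbb E[Y]$ is not of the form $\infty-\infty$ or $-\infty+\infty$. $\mathbb E$ is countably sub-additive if $\mathbb E(X)\le\sum_{n=1}^\infty\mathbb E(X_n)$ whenever $X\le\sum_{n=1}^\infty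 X_n$ with $X,X_n\in\mathcal H$, $X\ge0$, $X_n\ge0$. Capacity and Choquet integral. For $A\in\mathcal F$, $\mathbb V(A)=\inf\{\mathbb E[\xi]: I_A\le\xi,\ \xi\in\mathcal H\}$. For a random variable $X$, $C_{\mathbb V}(X)=\int_0^\infty\mathbb V(X>x)\,dx+\int_{-\infty}^0(\mathbb V(X>x)-1)\,dx$. Negative dependence. For random vectors $\mathbf X=(X_1,\dots,X_m)$ and $\mathbf Y=(Y_1,\dots,Y_n)$ with components in $\mathcal H$, $\mathbf Y$ is negatively dependent to $\mathbf X$ if for all $\psi_1\in C_{l,Lip}(\mathbb R^m)$, $\psi_2\in C_{l,Lip}(\mathbb R^n)$ one has $\mathbb E[\psi_1(\mathbf X)\psi_2(\mathbf Y)]\le\mathbb E[\psi_1(\mathbf X)]\,\mathbb E[\psi_2(\mathbf Y)]$ whenever $\psi_1(\mathbf X)\ge0$, $\mathbb E[\psi_2(\mathbf Y)]\ge0$, $\mathbb E[\psi_1(\mathbf X)\psi_2(\mathbf Y)]<\infty$, $\mathbb E[|\psi_1(\mathbf X)|]<\infty$, $\mathbb E[|\psi_2(\mathbf Y)|]<\infty$, and either $\psi_1,\psi_2$ are both coordinatewise nondecreasing or both coordinatewise nonincreasing. A sequence $\{X_n\}_{n\ge1}$ is negatively dependent if $X_{n+1}$ is negatively dependent to $(X_1,\dots,X_n)$ for each $n\ge1$; a doubly infinite sequence $\{Y_i,-\infty<i<\infty\}$ is negatively dependent if $Y_{n+1}$ is negatively dependent to $(Y_m,\dots,Y_n)$ for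 all integers $m\le n$. Identical distribution. $X_1,X_2\in\mathcal H$ are identically distributed if $\mathbb E[\psi(X_1)]=\mathbb E[\psi(X_2)]$ for every $\psi\in C_{l,Lip}(\mathbb R)$ whenever the sub-linear expectations are finite; ''$\{Y_i\}$ identically distributed as $Y$'' means that each $Y_i$ and $Y$ are identically distributed. Slow variation. A real function $l$, positive and measurable on $[0,\infty)$, is slowly varying at infinity if $\lim_{x\to\infty} l(\lambda x)/l(x)=1$ for each $\lambda>0$.
   Formalization: The formal theorem additionally assumes that each X_n belongs to H (the English does not say so, and fails without it, e.g. for cylinder functions of iid Gaussians); X_n need equal the series only where it converges absolutely. *)

(* Defs.v *)
From HB Require Import structures.
From mathcomp Require Import all_boot all_order all_algebra.
From mathcomp Require Import all_classical all_reals all_analysis.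

Set Implicit Arguments.
Unset Strict Implicit.
Unset Printing Implicit Defensive.
Import Order.TTheory GRing.Theory Num.Theory.
Import numFieldNormedType.Exports.
Local Open Scope classical_set_scope.
Local Open Scope ring_scope.

(* For V = 'rV[R]_n the norm is the sup norm; the class does not depend on the
   choice of the norm on R^n. *)
Definition C_lLip (R : realType) (V : normedModType R) (phi : V -> R) : Prop :=
  exists (C : R) (m : nat), 0 < C /\
    forall x y : V,
      `|phi x - phi y| <= C * (1 + `|x| ^+ m + `|y| ^+ m) * `|x - y|.

Definition random_vector (R : realType) (T : Type) (n : nat)
    (X : 'I_n -> T -> R) (w : T) : 'rV[R]_n := \row_i X i w.

Record rv_space (R : realType) (d : measure_display) (T : measurableType d)
    (H : set (T -> R)) : Prop := RvSpace {
  rv_measurable : forall X : T -> R, H X -> measurable_fun setT X;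
  rv_closed : forall (n : nat) (phi : 'rV[R]_n.+1 -> R) (X : 'I_n.+1 -> T -> R),
    C_lLip phi -> (forall i, H (X i)) -> H (phi \o random_vector X)
}.

(* E is a total function, but only its values on H are meaningful.
   [x +? y] says that x + y is not of the form oo - oo. *)
Record sublinear_expectation (R : realType) (T : Type) (H : set (T -> R))
    (E : (T -> R) -> \bar R) : Prop := SublinearExpectation {
  sle_mono : forall X Y : T -> R, H X -> H Y ->
    (forall w, Y w <= X w) -> (E Y <= E X)%E;
  sle_cst : forall c : R, E (cst c) = c%:E;
  sle_scale : forall (lambda : R) (X : T -> R), 0 <= lambda -> H X ->
    E (fun w => lambda * X w) = (lambda%:E * E X)%E;
  sle_subadd : forall X Y : T -> R, H X -> H Y ->
    (E X +? E Y)%E -> (E (fun w => X w + Y w)%R <= E X + E Y)%E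
}.

Definition countably_subadditive (R : realType) (T : Type) (H : set (T -> R))
    (E : (T -> R) -> \bar R) : Prop :=
  forall (X : T -> R) (Xs : nat -> T -> R),
    H X -> (forall n, H (Xs n)) ->
    (forall w, 0 <= X w) -> (forall n w, 0 <= Xs n w) ->
    (forall w, ((X w)%:E <= \sum_(n <oo) (Xs n w)%:E)%E) ->
    (E X <= \sum_(n <oo) E (Xs n))%E.

Definition capacity (R : realType) (T : Type) (H : set (T -> R))
    (E : (T -> R) -> \bar R) (A : set T) : \bar R :=
  ereal_inf [set E xi | xi in [set xi | H xi /\ forall w, \1_A w <= xi w]].

Definition choquet (R : realType) (T : Type) (V : set T -> \bar R)
    (X : T -> R) : \bar R :=
  (\int[lebesgue_measure]_(x in `[0%R, +oo[) V [set w | (x < X w)%R]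
   + \int[lebesgue_measure]_(x in `]-oo, 0%R]) (V [set w | (x < X w)%R] - 1))%E.

Definition coord_nondecreasing (R : realType) (n : nat) (psi : 'rV[R]_n -> R)
    : Prop :=
  forall x y : 'rV[R]_n, (forall i, x 0 i <= y 0 i) -> psi x <= psi y.

Definition coord_nonincreasing (R : realType) (n : nat) (psi : 'rV[R]_n -> R)
    : Prop :=
  forall x y : 'rV[R]_n, (forall i, x 0 i <= y 0 i) -> psi y <= psi x.

(* The vector Y is negatively dependent to the vector X. *)
Definition neg_dep_to (R : realType) (T : Type) (E : (T -> R) -> \bar R)
    (m n : nat) (X : 'I_m -> T -> R) (Y : 'I_n -> T -> R) : Prop :=
  forall (psi1 : 'rV[R]_m -> R) (psi2 : 'rV[R]_n -> R),
    C_lLip psi1 -> C_lLip psi2 ->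
    let U := psi1 \o random_vector X in
    let W := psi2 \o random_vector Y in
    (forall w, 0 <= U w) ->
    (0 <= E W)%E ->
    (E (fun w => U w * W w)%R < +oo)%E ->
    (E (fun w => `|U w|)%R < +oo)%E ->
    (E (fun w => `|W w|)%R < +oo)%E ->
    (coord_nondecreasing psi1 /\ coord_nondecreasing psi2) \/
    (coord_nonincreasing psi1 /\ coord_nonincreasing psi2) ->
    (E (fun w => U w * W w)%R <= E U * E W)%E.

(* Y_(m+k+1) is negatively dependent to (Y_m, ..., Y_(m+k)). *)
Definition neg_dep_biseq (R : realType) (T : Type) (E : (T -> R) -> \bar R)
    (Y : int -> T -> R) : Prop :=
  forall (m : int) (k : nat),
    neg_dep_to E (fun i : 'I_k.+1 => Y (m + (i : nat)%:Z))
                 (fun _ : 'I_1 => Y (m + k.+1%:Z)).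

Definition identically_distributed (R : realType) (T : Type)
    (E : (T -> R) -> \bar R) (X1 X2 : T -> R) : Prop :=
  forall psi : R -> R, C_lLip psi ->
    E (psi \o X1) \is a fin_num -> E (psi \o X2) \is a fin_num ->
    E (psi \o X1) = E (psi \o X2).

Definition slowly_varying (R : realType) (l : R -> R) : Prop :=
  [/\ forall x : R, 0 <= x -> 0 < l x,
      measurable_fun (`[0, +oo[%classic : set R) l
    & forall lambda : R, 0 < lambda ->
        l (lambda * x) / l x @[x --> +oo] --> (1 : R)].

(* Negz k is the integer -(k+1). *)
Definition bisum (R : realType) (u : int -> R) : R :=
  limn (series (fun k : nat => u (Posz k))) +
  limn (series (fun k : nat => u (Negz k))).

(* The process X_n = \sum_i a_i Y_(i+n), n >= 1, as random variables of the
   space: X_n belongs to H, and it is the sum of the series at every outcome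
   where the series converges absolutely.  Elsewhere its value is left free,
   since the series need not converge at every outcome. *)
Definition moving_average (R : realType) (T : Type) (H : set (T -> R))
    (a : int -> R) (Y : int -> T -> R) (X : nat -> T -> R) : Prop :=
  forall n : nat, (1 <= n)%N ->
    H (X n) /\
    forall w : T,
      summable [set: int] (fun i => (a i * Y (i + n%:Z) w)%:E) ->
      X n w = bisum (fun i => a i * Y (i + n%:Z) w).

(* Main.v *)
Require Import Defs.
From HB Require Import structures.
From mathcomp Require Import all_boot all_order all_algebra.
From mathcomp Require Import all_classical all_reals all_analysis.
From mathcomp Require Import measurable_realfun lra ring.

Set Implicit Arguments.
Unset Strict Implicit.
Unset Printing Implicit Defensive.
Import Order.TTheory GRing.Theory Num.Theory.
Import numFieldNormedType.Exports.
Local Open Scope classical_set_scope.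
Local Open Scope ring_scope.

(** Fix [n], put [b := f n] and let [s] be the sum, over [1 <= m <= n], of the
    Choquet integrals of [Psi_m (Y_m)] divided by [Psi_m b].  It suffices to show
    that, for [n] large, the capacity of the event of level [n] is at most [K * s],
    with [K] depending on [eps] and on the coefficients [a] only.

    All the moments that matter are carried by a single function, [profile b],
    which is [min (t, t ^ 2)] at [t := |y| / b].  As [p >= 1] and [q <= 2], the two
    monotonicity conditions put it below [Psi_m / Psi_m b] for every [m]
    ([profile_le]).  Countable subadditivity bounds the expectation of a nonnegative
    variable by its Choquet integral ([E_le_choquet]); since the [Y_i] have the same
    law, this gives [E (profile b Y_i) <= s / n] for every integer [i]
    ([E_profile_le]).  The bound is uniform in [i], so that all the translates of a
    block of length [n] can be treated alike.

    Truncate the variables at [-b] and [b].  The mean of the excess is at most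
    [b * s / n], hence so is the mean of the truncated variable, as [Y_i] is
    centered; its second moment is at most [b ^ 2 * s / n].  The largest sum of
    consecutive terms ending at time [n] is a reflected random walk, and negative
    dependence makes the cross term in the square of that walk nonpositive
    ([E_walk_step_le0]); its second moment is therefore at most [4 * b ^ 2 * s].
    Applied to both signs, this controls all the partial sums of a block by
    [b * (2 * eta + 2 * s + W_i)] where [E W_i] is of the order of [s]
    ([block_bound]).

    Finally the partial sums of the moving average are bounded by the sum over [i]
    of [|a_i|] times the bound for the [i]-th translate.  The deterministic part is
    at most [eps / 2 * b] for [n] large, and countable subadditivity applied to the
    sum of the [|a_i| * W_i] yields the claim ([moving_average_capacity]).  At the
    outcomes where one of the series defining the process diverges, the sum of the
    [|a_i| * W_i] is infinite and the comparison is trivial. *)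

(** * The random variables of the space and their sublinear expectation *)

Section Regularity.
Variable R : realType.
Implicit Types (V : normedModType R).

Lemma lipschitz_C_lLip V (phi : V -> R) (L : R) :
  (forall x y, `|phi x - phi y| <= L * `|x - y|) -> C_lLip phi.
Proof.
move=> phiL; exists (`|L| + 1), 0%N; split => [|x y]; first by rewrite ltr_wpDl.
rewrite !expr0; apply: le_trans (phiL x y) _; rewrite ler_wpM2r//.
by have := ler_norm L; have := normr_ge0 L; lra.
Qed.

Lemma sqr_C_lLip : C_lLip (fun x : R => x ^+ 2).
Proof.
exists 1, 1%N; split => // x y; rewrite !expr1 subr_sqr normrM mulrC ler_wpM2r//.
by have := ler_normD x y; lra.
Qed.

Lemma max_nonexpansive (a b c d : R) :
  `|Num.max a b - Num.max c d| <= `|a - c| + `|b - d|.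
Proof.
have := ler_norm (a - c); have := ler_norm (b - d).
have := lerNnormlW (lexx `|a - c|); have := lerNnormlW (lexx `|b - d|).
by rewrite ler_norml; case: (leP a b); case: (leP c d) => *; apply/andP; split; lra.
Qed.

Lemma max0_nonexpansive (a b : R) : `|Num.max 0 a - Num.max 0 b| <= `|a - b|.
Proof. by have := max_nonexpansive 0 a 0 b; rewrite subrr normr0 add0r. Qed.

Lemma coord_le_norm n (x : 'rV[R]_n.+1) i : `|x 0 i| <= `|x|.
Proof.
rewrite [leRHS]/Num.Def.normr /= mx_normrE.
exact: (@le_bigmax _ _ _ 0 (fun ij => `|x ij.1 ij.2|) (0, i)).
Qed.

End Regularity.

Section SublinearSpace.
Variables (R : realType) (d : measure_display) (T : measurableType d).
Variables (H : set (T -> R)) (E : (T -> R) -> \bar R).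
Hypothesis HH : rv_space H.
Hypothesis HE : sublinear_expectation H E.

Lemma H_comp (phi : R -> R) X : C_lLip phi -> H X -> H (fun w => phi (X w)).
Proof.
move=> [C [m [C0 phiC]]] HX.
have -> : (fun w => phi (X w)) =
    (fun x : 'rV[R]_1 => phi (x 0 0)) \o random_vector (fun=> X).
  by apply/funext => w /=; rewrite /random_vector mxE.
apply: (rv_closed HH) => //; exists C, m; split => // x y.
apply: le_trans (phiC _ _) _.
have h := coord_le_norm (x - y) 0; rewrite !mxE in h.
apply: ler_pM => //.
  by rewrite mulr_ge0 ?ltW// !addr_ge0// exprn_ge0.
rewrite ler_pM2l// !lerD//; rewrite lerXn2r ?nnegrE//; exact: coord_le_norm.
Qed.

Lemma H_lipschitz (phi : R -> R) X (L : R) :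
  (forall x y, `|phi x - phi y| <= L * `|x - y|) -> H X ->
  H (fun w => phi (X w)).
Proof. by move=> /lipschitz_C_lLip; exact: H_comp. Qed.

Lemma H_lipschitz2 (phi : R -> R -> R) X Y :
  (forall x y x' y', `|phi x y - phi x' y'| <= `|x - x'| + `|y - y'|) ->
  H X -> H Y -> H (fun w => phi (X w) (Y w)).
Proof.
move=> phiL HX HY; pose Z (i : 'I_2) := if i == 0 then X else Y.
have -> : (fun w => phi (X w) (Y w)) =
    (fun x : 'rV[R]_2 => phi (x 0 0) (x 0 1)) \o random_vector Z.
  by apply/funext => w /=; rewrite /random_vector !mxE.
apply: (rv_closed HH); last by move=> i; rewrite /Z; case: ifP.
apply: (@lipschitz_C_lLip _ _ _ 2) => x y; apply: le_trans (phiL _ _ _ _) _.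
have := coord_le_norm (x - y) 0; have := coord_le_norm (x - y) 1.
by rewrite !mxE; lra.
Qed.

(** Closure under functions of random vectors with at least one coordinate gives the
    constants only once a random variable is at hand; hence the variable [X0] carried
    by several of the lemmas below. *)
Lemma H_cst X (c : R) : H X -> H (cst c).
Proof.
move=> HX; apply: (@H_lipschitz (fun=> c) X 0) => // x y.
by rewrite subrr normr0 mul0r.
Qed.

Lemma H_add X Y : H X -> H Y -> H (fun w => X w + Y w).
Proof.
apply: H_lipschitz2 => x y x' y'.
by rewrite opprD addrACA; exact: ler_normD.
Qed.

Lemma H_max X Y : H X -> H Y -> H (fun w => Num.max (X w) (Y w)).
Proof. by apply: H_lipschitz2 => x y x' y'; exact: max_nonexpansive. Qed.

Lemma H_scale (c : R) X : H X -> H (fun w => c * X w).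
Proof.
by apply: (@H_lipschitz (fun x => c * x) X `|c|) => x y; rewrite -mulrBr normrM.
Qed.

Lemma H_opp X : H X -> H (fun w => - X w).
Proof.
by apply: (@H_lipschitz -%R X 1) => x y; rewrite -opprD normrN mul1r.
Qed.

Lemma H_sub X Y : H X -> H Y -> H (fun w => X w - Y w).
Proof. by move=> HX HY; apply: H_add => //; exact: H_opp. Qed.

Lemma H_abs X : H X -> H (fun w => `|X w|).
Proof.
apply: (@H_lipschitz Num.Def.normr X 1) => x y; rewrite mul1r; exact: ler_dist_dist.
Qed.

Lemma H_sqr X : H X -> H (fun w => X w ^+ 2).
Proof. exact: (H_comp (@sqr_C_lLip R)). Qed.

Lemma H_mul X Y : H X -> H Y -> H (fun w => X w * Y w).
Proof.
move=> HX HY.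
have -> : (fun w => X w * Y w) =
    fun w => 2^-1 * ((X w + Y w) ^+ 2 - (X w ^+ 2 + Y w ^+ 2)).
  by apply/funext => w; rewrite sqrrD; lra.
by apply/H_scale/H_sub; [exact/H_sqr/H_add|apply: H_add; exact: H_sqr].
Qed.

Lemma H_sum X0 (I : eqType) (r : seq I) (F : I -> T -> R) :
  H X0 -> (forall i, i \in r -> H (F i)) -> H (fun w => \sum_(i <- r) F i w).
Proof.
move=> HX0; elim: r => [|i r IH] HF.
  by under eq_fun do rewrite big_nil; exact: H_cst HX0.
under eq_fun do rewrite big_cons; apply: H_add; first exact/HF/mem_head.
by apply: IH => j jr; apply: HF; rewrite in_cons jr orbT.
Qed.

Lemma H_bigmax X0 (I : Type) (r : seq I) (F : I -> T -> R) :
  H X0 -> (forall i, H (F i)) -> H (fun w => \big[Num.max/0]_(i <- r) F i w).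
Proof.
move=> HX0 HF; elim: r => [|i r IH].
  by under eq_fun do rewrite big_nil; exact: H_cst HX0.
by under eq_fun do rewrite big_cons; exact: H_max.
Qed.

(** Upper bounds by reals, rather than values, are what propagates: below a
    finite bound the sum of two expectations is never [oo - oo]. *)
Lemma E_leD X Y (x y : R) : H X -> H Y ->
  (E X <= x%:E)%E -> (E Y <= y%:E)%E -> (E (fun w => X w + Y w)%R <= (x + y)%:E)%E.
Proof.
move=> HX HY Xx Yy; apply: le_trans (sle_subadd HE HX HY _) _.
  by apply: ltpinfty_adde_def; rewrite inE; apply: le_lt_trans (ltry _);
    [exact: Xx|exact: Yy].
by rewrite EFinD leeD.
Qed.

Lemma E_leZ X (c x : R) : H X -> 0 <= c -> (E X <= x%:E)%E ->
  (E (fun w => c * X w)%R <= (c * x)%:E)%E.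
Proof.
by move=> HX c0 Xx; rewrite (sle_scale HE)// EFinM lee_wpmul2l// lee_fin.
Qed.

Lemma E_le X Y (x : R) : H X -> H Y -> (forall w, X w <= Y w) ->
  (E Y <= x%:E)%E -> (E X <= x%:E)%E.
Proof. by move=> HX HY XY; apply: le_trans; exact: (sle_mono HE). Qed.

Lemma E_le_cst X (c : R) : H X -> (forall w, X w <= c) -> (E X <= c%:E)%E.
Proof.
by move=> HX Xc; rewrite -(sle_cst HE) (sle_mono HE)//; exact: H_cst HX.
Qed.

Lemma E_ge_cst X (c : R) : H X -> (forall w, c <= X w) -> (c%:E <= E X)%E.
Proof.
by move=> HX Xc; rewrite -(sle_cst HE) (sle_mono HE)//; exact: H_cst HX.
Qed.

Lemma E_ge0 X : H X -> (forall w, 0 <= X w) -> (0 <= E X)%E.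
Proof. exact: E_ge_cst. Qed.

Lemma E_fin X (c : R) : H X -> (forall w, `|X w| <= c) -> E X \is a fin_num.
Proof.
move=> HX Xc; rewrite fin_numElt; apply/andP; split.
  apply: lt_le_trans (ltNyr (- c)) (E_ge_cst HX _) => w.
  by have := Xc w; rewrite ler_norml => /andP[].
apply: le_lt_trans (E_le_cst HX (c := c) _) (ltry c) => w.
by have := Xc w; rewrite ler_norml => /andP[].
Qed.

Lemma E_leB_cst X (c x : R) : H X -> (E X <= x%:E)%E ->
  (E (fun w => X w - c)%R <= (x - c)%:E)%E.
Proof.
move=> HX Xx; apply: E_leD => //; first exact: H_cst HX.
by rewrite (sle_cst HE).
Qed.

(** Subadditivity alone gives one inequality of [E (X - c) = E X - c]; the other
    is the same inequality for the translation back by [c]. *)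
Lemma E_centered X (c : R) : H X -> E X = c%:E -> E (fun w => X w - c)%R = 0%E.
Proof.
move=> HX Xc; have HXc : H (fun w => X w - c) by apply: H_sub (H_cst _ HX).
have le0 : (E (fun w => X w - c)%R <= 0)%E.
  by have := @E_leB_cst X c c HX; rewrite Xc subrr; apply.
apply/eqP; rewrite eq_le le0/= leNgt; apply/negP => lt0.
have [r Er] : exists2 r : R, r < 0 & (E (fun w => X w - c)%R <= r%:E)%E.
  case: (E _) lt0 => [r||]//; first by rewrite lte_fin => r0; exists r.
  by move=> _; exists (-1); rewrite ?leNye// ltrN10.
move=> Ele; have := E_leB_cst (- c) HXc Ele.
have -> : (fun w => X w - c - - c) = X by apply/funext => w; rewrite opprK subrK.
by rewrite Xc lee_fin; lra.
Qed.

Lemma E_sum_le X0 (I : eqType) (r : seq I) (F : I -> T -> R) (c : R) :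
  H X0 -> (forall i, H (F i)) -> (forall i, (E (F i) <= c%:E)%E) ->
  (E (fun w => \sum_(i <- r) F i w)%R <= ((size r)%:R * c)%:E)%E.
Proof.
move=> HX0 HF Fc; elim: r => [|i r IH].
  by under eq_fun do rewrite big_nil; rewrite (sle_cst HE) mul0r.
under eq_fun do rewrite big_cons.
rewrite /= -nat1r mulrDl mul1r; apply: E_leD => //; exact: H_sum HX0 _.
Qed.

Lemma capacity_le xi (A : set T) :
  H xi -> (forall w, \1_A w <= xi w) -> (capacity H E A <= E xi)%E.
Proof. by move=> Hxi Axi; apply: ereal_inf_lbound; exists xi. Qed.

Lemma capacity_ge0 (A : set T) : (0 <= capacity H E A)%E.
Proof.
apply: le_ereal_inf_tmp => _ [xi [Hxi Axi] <-]; apply: E_ge0 => // w.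
by apply: le_trans (Axi w); rewrite indicE.
Qed.

Lemma capacity_mono (A B : set T) : A `<=` B ->
  (capacity H E A <= capacity H E B)%E.
Proof.
move=> AB; apply: ereal_inf_le_tmp => _ [xi [Hxi Bxi] <-]; exists xi => //; split => // w.
apply: le_trans (Bxi w); rewrite !indicE ler_nat.
by case: (boolP (w \in A)) => // /set_mem/AB/mem_set ->.
Qed.

Lemma capacity_le1 X0 (A : set T) : H X0 -> (capacity H E A <= 1)%E.
Proof.
move=> HX0; rewrite -(sle_cst HE 1); apply: (@capacity_le (cst 1)) => [|w].
  exact: H_cst HX0.
by rewrite indicE /= lern1 leq_b1.
Qed.

Lemma capacityT X0 : H X0 -> capacity H E setT = 1%E.
Proof.
move=> HX0; apply/eqP; rewrite eq_le (capacity_le1 _ HX0)/=.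
apply: le_ereal_inf_tmp => _ [xi [Hxi Axi] <-]; apply: E_ge_cst => // w.
by apply: le_trans (Axi w); rewrite indicE in_setT.
Qed.

End SublinearSpace.

(** * Expectation and layers *)

Section Layers.
Variable R : realType.

Lemma series_le_integral (h : R -> R) (delta : R) : 0 < delta ->
  (forall x, 0 <= h x) -> {homo h : x y /~ x <= y} ->
  (delta%:E * \sum_(k <oo) (h (k.+1%:R * delta))%:E
     <= \int[lebesgue_measure]_(x in `[0%R, +oo[) (h x)%:E)%E.
Proof.
move=> d0 h0 hmono; have d0' := ltW d0.
have mh D : measurable D -> measurable_fun D (EFin \o h).
  move=> mD; apply/measurable_EFinP; apply: nonincreasing_measurable => // m n; exact: hmono.
pose F (k : nat) : set R := `[k%:R * delta, k.+1%:R * delta[%classic.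
have mF k : measurable (F k) by exact: measurable_itv.
have tF : trivIset setT F.
  apply: ltn_trivIset => n m mn; apply/seteqP; split => // x [].
  rewrite /F /= !in_itv /= => /andP[_ xm] /andP[nx _].
  have : m.+1%:R * delta <= n%:R * delta by rewrite ler_pM2r// ler_nat.
  by lra.
have mU : measurable (\bigcup_k F k) by exact: bigcup_measurable.
have : (\int[lebesgue_measure]_(x in \bigcup_k F k) (h x)%:E <=
    \int[lebesgue_measure]_(x in `[0%R, +oo[) (h x)%:E)%E.
  apply: ge0_subset_integral => //=; first exact: mh.
    by move=> x _; rewrite lee_fin.
  move=> x [k _]; rewrite /F /= !in_itv /= andbT => /andP[kx _].
  by apply: le_trans kx; apply: mulr_ge0.
apply: le_trans; rewrite ge0_integral_bigcup//; [|exact: (mh _ mU)|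
  by move=> x _; rewrite lee_fin].
rewrite -nneseriesZl; last by move=> k _; rewrite lee_fin.
apply: lee_nneseries => k _.
  by rewrite mule_ge0// lee_fin.
have : ((delta%:E * (h (k.+1%:R * delta))%:E) =
    \int[lebesgue_measure]_(x in F k) (cst (h (k.+1%:R * delta))%:E x))%E.
  rewrite integral_cst; last exact: mF.
  rewrite /F /= lebesgue_measure_itv /= lte_fin ltr_pM2r// ltr_nat ltnSn.
  by rewrite -EFinB -mulrBl -natr1 addrAC subrr add0r mul1r muleC.
move=> ->; apply: ge0_le_integral => //=.
- exact: mF.
- by move=> x _; rewrite lee_fin.
- exact: (mh _ (mF k)).
- move=> x; rewrite /F /= in_itv /= => /andP[_ /ltW xk]; rewrite lee_fin; exact: hmono.
Qed.

(** The part of [x] lying between the levels [k] and [k + 1]. *)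
Definition layer (k : nat) (x : R) : R :=
  Num.max 0 (x - k%:R) - Num.max 0 (x - k.+1%:R).

Lemma layer_bound k x : 0 <= layer k x <= 1.
Proof.
rewrite /layer -natr1.
by case: (leP 0 (x - k%:R)) => ?; case: (leP 0 (x - (k%:R + 1))) => ?;
  apply/andP; split; lra.
Qed.

Lemma layer_eq0 k x : x <= k%:R -> layer k x = 0.
Proof.
by rewrite /layer -natr1 => xk; rewrite !max_l ?subrr//; lra.
Qed.

Lemma layer_nonexpansive k x y : `|layer k x - layer k y| <= 2 * `|x - y|.
Proof.
rewrite /layer.
set a := Num.max 0 (x - _); set b := Num.max 0 (x - _).
set c := Num.max 0 (y - _); set e := Num.max 0 (y - _).
have -> : a - b - (c - e) = (a - c) - (b - e) by lra.
apply: le_trans (ler_normB _ _) _; rewrite mulrDl mul1r; apply: lerD.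
  by apply: le_trans (max0_nonexpansive _ _) _; rewrite opprB addrA subrK.
by apply: le_trans (max0_nonexpansive _ _) _; rewrite opprB addrA subrK.
Qed.

Lemma layers_sum x : 0 <= x -> (x%:E <= \sum_(k <oo) (layer k x)%:E)%E.
Proof.
move=> x0; pose N := Num.bound x.
have xN : x <= N%:R by rewrite ltW//; have := archi_boundP x0.
apply: le_trans (nneseries_lim_ge N _); last first.
  by move=> k _ _; rewrite lee_fin; case/andP: (layer_bound k x).
rewrite sumEFin lee_fin.
have -> : \sum_(0 <= k < N) layer k x
    = - \sum_(0 <= k < N) (Num.max 0 (x - k.+1%:R) - Num.max 0 (x - k%:R)).
  by rewrite -sumrN; apply: eq_bigr => k _; rewrite opprB.
rewrite telescope_sumr// subr0 (max_l (y := x - N%:R)); last by lra.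
by rewrite sub0r opprK le_max lexx orbT.
Qed.

End Layers.

Section Choquet.
Variables (R : realType) (d : measure_display) (T : measurableType d).
Variables (H : set (T -> R)) (E : (T -> R) -> \bar R).
Hypothesis HH : rv_space H.
Hypothesis HE : sublinear_expectation H E.

Lemma choquet_ge0E X0 (X : T -> R) : H X0 -> (forall w, 0 <= X w) ->
  choquet (capacity H E) X =
  (\int[lebesgue_measure]_(x in `[0%R, +oo[) capacity H E [set w | (x < X w)%R])%E.
Proof.
move=> HX0 X_ge0; rewrite /choquet -[RHS]adde0; congr (_ + _)%E.
have Vneg x : x \in `]-oo, 0%R[%classic ->
    (capacity H E [set w | (x < X w)%R] - 1 = 0)%E.
  rewrite inE /= in_itv /= => x0.
  have -> : [set w | x < X w] = setT.
    by apply/seteqP; split => // w _ /=; exact: lt_le_trans x0 _.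
  by rewrite (capacityT HH HE HX0) subee.
rewrite -integral_itv_bndo_bndc; last first.
  by apply: (eq_measurable_fun (cst 0%E)) => // x /Vneg.
by under eq_integral do rewrite Vneg//; rewrite integral0.
Qed.

Hypothesis HEc : countably_subadditive H E.

(** Equality of laws is tested on functions with finite expectations only, so that
    it is applied to the bounded layers of [psi]; each layer of [psi (U')] is below
    the indicator of the event that defines its capacity. *)
Lemma E_layers (psi : R -> R) (L : R) (U U' U0 : T -> R) :
  (forall x, 0 <= psi x) -> (forall x y, `|psi x - psi y| <= L * `|x - y|) ->
  H U -> H U' -> H U0 -> identically_distributed E U U0 ->
  identically_distributed E U' U0 ->
  (E (fun w => psi (U w))%R <=
     \sum_(k <oo) capacity H E [set w | (k%:R < psi (U' w))%R])%E.
Proof.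
move=> psi0 psiL HU HU' HU0 UU0 U'U0.
have lL k x y : `|layer k (psi x) - layer k (psi y)| <= 2 * L * `|x - y|.
  apply: le_trans (layer_nonexpansive _ _ _) _; rewrite -mulrA ler_wpM2l//.
have lH k V : H V -> H (fun w => layer k (psi (V w))).
  by move=> HV; apply: (H_lipschitz HH (lL k) HV).
have fin k V : H V -> E (fun w => layer k (psi (V w))) \is a fin_num.
  move=> HV; apply: (E_fin HH HE (lH k V HV) (c := 1)) => w.
  have /andP[? ?] := layer_bound k (psi (V w)).
  by rewrite ger0_norm.
have l01 k (x : R) : 0 <= layer k x /\ layer k x <= 1.
  by apply/andP; exact: layer_bound.
have layer0 k w : 0 <= layer k (psi (U w)) by case: (l01 k (psi (U w))).
have Hpsi : H (fun w => psi (U w)) := H_lipschitz HH psiL HU.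
have cover w : ((psi (U w))%:E <= \sum_(k <oo) (layer k (psi (U w)))%:E)%E.
  exact: layers_sum.
apply: le_trans (HEc Hpsi (fun k => lH k U HU) (fun w => psi0 (U w)) layer0 cover) _.
apply: lee_nneseries => [k _ _|k _].
  exact: (E_ge0 HH HE (lH k U HU) (layer0 k)).
have lC := lipschitz_C_lLip (lL k).
have -> : E (fun w => layer k (psi (U w))) = E (fun w => layer k (psi (U' w))).
  transitivity (E ((layer k \o psi) \o U0)); [apply: UU0|symmetry; apply: U'U0];
    by [exact: lC|exact: fin].
apply: le_ereal_inf_tmp => _ [xi [Hxi xi1] <-].
apply: (sle_mono HE) => // [|w]; first exact: lH.
have := xi1 w; rewrite indicE.
have [kw|kw] := ltP k%:R (psi (U' w)).
  rewrite mem_set//=; apply: le_trans.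
  by case: (l01 k (psi (U' w))).
by rewrite layer_eq0//; apply: le_trans; case: (_ \in _).
Qed.

End Choquet.

(** * Comparison with the Choquet integral *)

Section ChoquetBound.
Variables (R : realType) (d : measure_display) (T : measurableType d).
Variables (H : set (T -> R)) (E : (T -> R) -> \bar R).
Hypothesis HH : rv_space H.
Hypothesis HE : sublinear_expectation H E.
Hypothesis HEc : countably_subadditive H E.

Lemma capacity_fin X0 A : H X0 -> capacity H E A \is a fin_num.
Proof.
move=> HX0; rewrite ge0_fin_numE ?(capacity_ge0 HH HE)//.
exact: le_lt_trans (capacity_le1 HH HE A HX0) (ltry 1).
Qed.

Lemma choquet_ge0 X0 (X : T -> R) : H X0 -> (forall w, 0 <= X w) ->
  (0 <= choquet (capacity H E) X)%E.
Proof.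
move=> HX0 X_ge0; rewrite (choquet_ge0E HH HE HX0 X_ge0).
by apply: integral_ge0 => x _; exact: (capacity_ge0 HH HE).
Qed.

Lemma series_le_choquet X0 (X : T -> R) (delta : R) : H X0 ->
  (forall w, 0 <= X w) -> 0 < delta ->
  (delta%:E * \sum_(k <oo) capacity H E [set w | (k.+1%:R * delta < X w)%R]
     <= choquet (capacity H E) X)%E.
Proof.
move=> HX0 X_ge0 d0; rewrite (choquet_ge0E HH HE HX0 X_ge0).
pose h x := fine (capacity H E [set w | x < X w]).
have hE x : capacity H E [set w | x < X w] = (h x)%:E.
  by rewrite fineK//; exact: capacity_fin HX0.
under eq_eseriesr do rewrite hE.
under eq_integral do rewrite hE.
apply: series_le_integral => // [x|x y xy]; rewrite -lee_fin -!hE.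
  exact: (capacity_ge0 HH HE).
by apply: capacity_mono => w /=; exact: le_lt_trans.
Qed.

(** Layers of height [delta] for [phi] correspond to levels of [Psi] spaced by
    [c * delta].  The sum over the layers above the first one is a lower Riemann sum
    of the Choquet integral; the first layer contributes at most [delta], which is
    arbitrary. *)
Lemma E_le_choquet (phi Psi : R -> R) (L c : R) (U U' U0 : T -> R) :
  (forall x, 0 <= phi x) -> (forall x y, `|phi x - phi y| <= L * `|x - y|) ->
  0 < c -> (forall x, c * phi x <= Psi x) ->
  H U -> H U' -> H U0 ->
  identically_distributed E U U0 -> identically_distributed E U' U0 ->
  (E (fun w => phi (U w))%R
     <= choquet (capacity H E) (Psi \o U') * (c^-1)%:E)%E.
Proof.
move=> phi0 phiL c0 phiPsi HU HU' HU0 UU0 U'U0.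
have Psi0 w : 0 <= (Psi \o U') w by apply: le_trans (phiPsi _); rewrite mulr_ge0// ltW.
apply/lee_addgt0Pr => delta d0.
pose psi x := delta^-1 * phi x.
have psi0 x : 0 <= psi x by rewrite mulr_ge0// invr_ge0 ltW.
have psiL x y : `|psi x - psi y| <= (delta^-1 * L) * `|x - y|.
  by rewrite -mulrBr normrM gtr0_norm ?invr_gt0// -mulrA ler_pM2l ?invr_gt0.
have Hphi : H (fun w => phi (U w)) := H_lipschitz HH phiL HU.
have := E_layers HH HE HEc psi0 psiL HU HU' HU0 UU0 U'U0.
have di0 : 0 <= delta^-1 by rewrite invr_ge0 ltW.
rewrite (sle_scale HE di0 Hphi).
rewrite lee_pdivrMl// => /le_trans; apply.
have V0 k : (0 <= capacity H E [set w | (k%:R < psi (U' w))%R])%E.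
  exact: (capacity_ge0 HH HE).
rewrite nneseries_recl// -(nneseries_addn 1)// muleDr//; last first.
  by apply: ge0_adde_def; rewrite inE ?V0// nneseries_ge0.
rewrite addeC; apply: leeD; last first.
  rewrite -[leRHS]mule1; apply: lee_wpmul2l; first by rewrite lee_fin ltW.
  exact: (capacity_le1 HH HE _ HU0).
rewrite lee_pdivlMr// muleAC -EFinM (mulrC _ c).
apply: le_trans (series_le_choquet HU0 Psi0 (mulr_gt0 c0 d0)).
apply: lee_wpmul2l; first by rewrite lee_fin ltW// mulr_gt0.
apply: lee_nneseries => [k _ _|k _]; first exact: V0.
apply: capacity_mono => w /=; rewrite addn1 /psi mulrC ltr_pdivlMr// => kphi.
apply: lt_le_trans (phiPsi _); rewrite mulrCA ltr_pM2l//.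
Qed.

End ChoquetBound.

Lemma min_sqr_lipschitz (R : realFieldType) (s t : R) : 0 <= s -> 0 <= t ->
    `|Num.min s (s ^+ 2) - Num.min t (t ^+ 2)| <= 2 * `|s - t|.
Proof.
have minE (r : R) : 0 <= r -> Num.min r (r ^+ 2) = if r <= 1 then r ^+ 2 else r.
  move=> r0; rewrite expr2; case: (leP r 1) => r1; [apply: min_r|apply: min_l].
    exact: ler_piMl.
  by rewrite ler_peMl// ltW.
move=> s0 t0; rewrite !minE//.
have : s - t <= `|s - t| by exact: ler_norm.
have : - `|s - t| <= s - t by exact: lerNnormlW.
move: `|s - t| => a a2 a1.
rewrite ler_norml !expr2.
case: (leP s 1) => s1; case: (leP t 1) => t1.
- have p1 : 0 <= (a - (s - t)) * (s + t) by apply: mulr_ge0; lra.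
  have p2 : 0 <= (a + (s - t)) * (s + t) by apply: mulr_ge0; lra.
  have p3 : 0 <= a * (2 - (s + t)) by apply: mulr_ge0; lra.
  by apply/andP; split; lra.
- have p3 : 0 <= s * (1 - s) by apply: mulr_ge0; lra.
  have := sqr_ge0 (1 - s); rewrite !expr2 => q1.
  by apply/andP; split; lra.
- have p3 : 0 <= t * (1 - t) by apply: mulr_ge0; lra.
  have := sqr_ge0 (1 - t); rewrite !expr2 => q1.
  by apply/andP; split; lra.
- by apply/andP; split; lra.
Qed.

Section Profile.
Variable R : realType.

(** Quadratic up to the level [b] and linear beyond, so that it controls both the
    second moment of a variable truncated at [b] and the mean of its excess. *)
Definition profile (b y : R) : R := Num.min (`|y| / b) ((y / b) ^+ 2).

Lemma profile_ge0 b y : 0 < b -> 0 <= profile b y.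
Proof. by move=> b0; rewrite le_min sqr_ge0 divr_ge0// ltW. Qed.

Lemma profile_lipschitz b x y : 0 < b ->
  `|profile b x - profile b y| <= 2 * b^-1 * `|x - y|.
Proof.
move=> b0; have sq z : (z / b) ^+ 2 = (`|z| / b) ^+ 2.
  by rewrite !exprMn real_normK ?num_real.
have n0 (z : R) : 0 <= `|z| / b by rewrite divr_ge0// ltW.
rewrite /profile (sq x) (sq y); apply: le_trans (min_sqr_lipschitz (n0 x) (n0 y)) _.
rewrite -mulrBl normrM (gtr0_norm (x := b^-1)) ?invr_gt0//.
rewrite -mulrA ler_pM2l// mulrC ler_pM2l ?invr_gt0//.
exact: ler_dist_dist.
Qed.

(** Below the level [b] the quadratic part is compared with the power [q], beyond it
    the linear part is compared with the power [p]. *)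
Lemma profile_le (Psi : R -> R) (p q b : R) : 1 <= p -> q <= 2 ->
  (forall t, 0 <= Psi t) ->
  (forall s t : R, 0 < `|s| -> `|s| <= `|t| ->
     Psi s / `|s| `^ p <= Psi t / `|t| `^ p) ->
  (forall s t : R, 0 < `|s| -> `|s| <= `|t| ->
     Psi t / `|t| `^ q <= Psi s / `|s| `^ q) ->
  0 < b -> forall y, Psi b * profile b y <= Psi y.
Proof.
move=> p1 q2 Psi0 incr decr b0 y.
have [->|y0] := eqVneq y 0.
  by rewrite /profile normr0 !mul0r expr0n/= minxx mulr0.
have ny0 : 0 < `|y| by rewrite normr_gt0.
have bE : `|b| = b by rewrite gtr0_norm.
have r0 : 0 < `|y| / b by rewrite divr_gt0.
have powE r : (`|y| / b) `^ r = `|y| `^ r / b `^ r.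
  by rewrite powRM ?invr_ge0 ?ltW// -powR_inv1 ?ltW// -powRrM mulN1r powRN.
have [yb|yb] := leP `|y| b.
  have := decr y b; rewrite bE => /(_ ny0 yb).
  rewrite ler_pdivrMr ?powR_gt0// => h.
  have {}h : Psi b * (`|y| / b) `^ q <= Psi y.
    rewrite powE mulrA ler_pdivrMr ?powR_gt0//.
    by rewrite mulrAC -ler_pdivlMr ?powR_gt0// mulrAC in h *.
  apply: le_trans h; rewrite ler_wpM2l//.
  have -> : profile b y = (`|y| / b) `^ 2.
    rewrite powR_mulrn ?ltW// /profile -(real_normK (num_real (y / b))) normrM normfV bE.
    rewrite min_r// expr2 ger_pMr// ler_pdivrMr// mul1r//.
  by apply: ger_powR => //; rewrite r0 ler_pdivrMr// mul1r.
have := incr b y; rewrite bE => /(_ b0 (ltW yb)).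
rewrite ler_pdivlMr ?powR_gt0// => h.
have {}h : Psi b * (`|y| / b) `^ p <= Psi y.
  by rewrite powE mulrA mulrAC.
apply: le_trans h; rewrite ler_wpM2l//.
have r1 : 1 <= `|y| / b by rewrite ler_pdivlMr// mul1r ltW.
by apply: le_trans (le1r_powR r1 p1); rewrite ge_min lexx.
Qed.

End Profile.

Section ProfileBound.
Variables (R : realType) (d : measure_display) (T : measurableType d).
Variables (H : set (T -> R)) (E : (T -> R) -> \bar R).
Hypothesis HH : rv_space H.
Hypothesis HE : sublinear_expectation H E.
Hypothesis HEc : countably_subadditive H E.
Variables (Y : int -> T -> R) (Y0 : T -> R).
Hypothesis HY : forall i, H (Y i).
Hypothesis HY0 : H Y0.
Hypothesis HYid : forall i, identically_distributed E (Y i) Y0.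
Variables (Psi : nat -> R -> R) (p q : R).
Hypothesis HPsi_ge0 : forall n, (1 <= n)%N -> forall t, 0 <= Psi n t.
Hypothesis HPsi_gt0 : forall n, (1 <= n)%N -> forall t, 0 < t -> 0 < Psi n t.
Hypothesis p1 : 1 <= p.
Hypothesis q2 : q <= 2.
Hypothesis HPsi_p : forall n, (1 <= n)%N -> forall s t : R,
      0 < `|s| -> `|s| <= `|t| ->
      Psi n s / `|s| `^ p <= Psi n t / `|t| `^ p.
Hypothesis HPsi_q : forall n, (1 <= n)%N -> forall s t : R,
      0 < `|s| -> `|s| <= `|t| ->
      Psi n t / `|t| `^ q <= Psi n s / `|s| `^ q.

Lemma choquet_ratio_ge0 (b : R) m : (1 <= m)%N ->
  (0 <= choquet (capacity H E) (Psi m \o Y m%:Z) * ((Psi m b)^-1)%:E)%E.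
Proof.
move=> m1; apply: mule_ge0.
  by apply: (choquet_ge0 HH HE HY0) => w; exact: HPsi_ge0.
by rewrite lee_fin invr_ge0 HPsi_ge0.
Qed.

(** As all the variables have the law of [Y0], the mean of the profile at an index
    [i] in [Z] is below each of the [n] terms of the sum, hence below their average. *)
Lemma E_profile_le (b s : R) (n : nat) i : (0 < n)%N -> 0 < b ->
  (\sum_(1 <= m < n.+1)
     (choquet (capacity H E) (Psi m \o Y m%:Z) * ((Psi m b)^-1)%:E) <= s%:E)%E ->
  (E (fun w => profile b (Y i w))%R <= (s / n%:R)%:E)%E.
Proof.
move=> n0 b0 sum_le; set e := E _.
have e0 : (0 <= e)%E.
  apply: (E_ge0 HH HE) => [|w]; last exact: profile_ge0.
  by apply: (H_lipschitz HH (L := 2 * b^-1)) => // x y; exact: profile_lipschitz.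
have eu m : (1 <= m)%N ->
    (e <= choquet (capacity H E) (Psi m \o Y m%:Z) * ((Psi m b)^-1)%:E)%E.
  move=> m1; apply: (E_le_choquet HH HE HEc (L := 2 * b^-1) (U0 := Y0)) => //.
  - by move=> x; exact: profile_ge0.
  - by move=> x y; exact: profile_lipschitz.
  - exact: HPsi_gt0.
  - by apply: (profile_le p1 q2) => //; [exact: HPsi_ge0|exact: HPsi_p|exact: HPsi_q].
have : (\sum_(1 <= m < n.+1) e <= s%:E)%E.
  apply: le_trans sum_le; rewrite big_seq [leRHS]big_seq; apply: lee_sum => m.
  by rewrite mem_index_iota => /andP[m1 _]; exact: eu.
case: e e0 {eu} => [r||]//= r0 h.
  move: h; rewrite sumEFin lee_fin sumr_const_nat subn1 /= => h.
  by rewrite lee_fin ler_pdivlMr ?ltr0n// mulr_natr.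
have : (+oo <= s%:E)%E by apply: le_trans h; rewrite big_nat_recr//= leeDr// sume_ge0.
by [].
Qed.

End ProfileBound.

(** * Maximal inequality under negative dependence *)

Section ReflectedWalk.
Variable R : realType.
Implicit Types x y : nat -> R.

(** The walk with increments [x] reflected at [0]; its value at time [n] is
    [max_(k <= n) (x_k + ... + x_(n-1))], the largest of the sums that end at [n]. *)
Fixpoint reflected_walk x (n : nat) : R :=
  if n is k.+1 then Num.max 0 (reflected_walk x k + x k) else 0.

Lemma reflected_walk_ge0 x n : 0 <= reflected_walk x n.
Proof. by case: n => //= n; rewrite le_max lexx. Qed.

Lemma sum_le_reflected_walk x n k : (k <= n)%N ->
  \sum_(k <= j < n) x j <= reflected_walk x n.
Proof.
elim: n => [|n IH]; first by rewrite leqn0 => /eqP->; rewrite big_geq.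
rewrite leq_eqVlt => /orP[/eqP->|kn].
  by rewrite big_geq// reflected_walk_ge0.
rewrite big_nat_recr//= le_max; apply/orP; right.
by rewrite lerD2r; exact: IH.
Qed.

Lemma reflected_walk_sqr x n :
  reflected_walk x n.+1 ^+ 2 <=
  reflected_walk x n ^+ 2 + (2 * (reflected_walk x n * x n) + x n ^+ 2).
Proof.
rewrite /=; set r := reflected_walk x n.
have -> : r ^+ 2 + (2 * (r * x n) + x n ^+ 2) = (r + x n) ^+ 2.
  by rewrite sqrrD addrA mulr_natl.
case: (leP 0 (r + x n)) => // h; rewrite expr0n /=; exact: sqr_ge0.
Qed.

Lemma reflected_walk_le x (c : R) n : 0 <= c -> (forall j, x j <= c) ->
  reflected_walk x n <= n%:R * c.
Proof.
move=> c0 xc; elim: n => [|n IH] /=; first by rewrite mul0r.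
rewrite ge_max mulr_ge0//= -natr1 mulrDl mul1r lerD//.
Qed.

Lemma le_reflected_walk x y n : (forall j, (j < n)%N -> x j <= y j) ->
  reflected_walk x n <= reflected_walk y n.
Proof.
elim: n => //= n IH xy; rewrite ge_max !le_max lexx /=; apply/orP; right.
by apply: lerD; [apply: IH => j jn; apply: xy; exact: ltnW|exact: xy].
Qed.

Lemma eq_reflected_walk x y n : (forall j, (j < n)%N -> x j = y j) ->
  reflected_walk x n = reflected_walk y n.
Proof.
by move=> xy; apply/eqP; rewrite eq_le !le_reflected_walk// => j /xy->.
Qed.

Lemma reflected_walk_lipschitz x y (c : R) n :
  (forall j, (j < n)%N -> `|x j - y j| <= c) ->
  `|reflected_walk x n - reflected_walk y n| <= n%:R * c.
Proof.
elim: n => [_|n IH xy] /=; first by rewrite subrr normr0 mul0r.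
apply: le_trans (max0_nonexpansive _ _) _.
rewrite opprD addrACA; apply: le_trans (ler_normD _ _) _.
rewrite -natr1 mulrDl mul1r; apply: lerD; last exact: xy.
by apply: IH => j jn; apply: xy; exact: ltnW.
Qed.

End ReflectedWalk.

Section NegativeDependence.
Variables (R : realType) (d : measure_display) (T : measurableType d).
Variables (H : set (T -> R)) (E : (T -> R) -> \bar R).
Hypothesis HH : rv_space H.
Hypothesis HE : sublinear_expectation H E.
Variable Y : int -> T -> R.
Hypothesis HY : forall i, H (Y i).
Hypothesis HYnd : neg_dep_biseq E Y.

Variables (zeta : R -> R) (c v : R).
Hypothesis zeta_lip : forall x y, `|zeta x - zeta y| <= `|x - y|.
Hypothesis zeta_mono : {homo zeta : x y / x <= y} \/ {homo zeta : x y /~ x <= y}.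
Hypothesis zeta_bnd : forall x, `|zeta x| <= c.
Hypothesis zeta_mean : forall i, E (fun w => zeta (Y i w)) = 0%E.
Hypothesis zeta_var : forall i, (E (fun w => zeta (Y i w) ^+ 2)%R <= v%:E)%E.

Let walk m n w := reflected_walk (fun j : nat => zeta (Y (m + j%:Z) w)) n.

Lemma increment_bound_ge0 : 0 <= c. Proof. exact: le_trans (normr_ge0 _) (zeta_bnd 0). Qed.

Lemma H_zeta i : H (fun w => zeta (Y i w)).
Proof. by apply: (H_lipschitz HH (L := 1)) => // x y; rewrite mul1r. Qed.

Lemma H_walk m n : H (walk m n).
Proof.
rewrite /walk; elim: n => [|n IH] /=; first exact: (H_cst HH 0 (HY 0)).
by apply: (H_max HH (H_cst HH 0 (HY 0))); apply: H_add => //; exact: H_zeta.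
Qed.

Lemma walk_bound m n w : 0 <= walk m n w <= n%:R * c.
Proof.
rewrite reflected_walk_ge0 /=; apply: reflected_walk_le => [|j].
  exact: increment_bound_ge0.
exact: le_trans (ler_norm _) (zeta_bnd _).
Qed.

(** Negative dependence makes the cross term of the square nonpositive: the
    reflected walk and its next increment are nonnegative, respectively centered,
    and monotone in the same direction. *)
Lemma E_walk_step_le0 m n :
  (E (fun w => walk m n w * zeta (Y (m + n%:Z) w))%R <= 0)%E.
Proof.
case: n => [|k].
  rewrite /walk /=; under eq_fun do rewrite mul0r.
  by rewrite (sle_cst HE).
pose psi1 (x : 'rV[R]_k.+1) :=
  reflected_walk (fun j => zeta (x 0 (inord j))) k.+1.
pose psi2 (x : 'rV[R]_1) := zeta (x 0 0).
have psi1E w : psi1 (random_vector (fun i : 'I_k.+1 => Y (m + (i : nat)%:Z)) w)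
    = walk m k.+1 w.
  by apply: eq_reflected_walk => j jk; rewrite /random_vector mxE inordK.
have psi2E w : psi2 (random_vector (fun=> Y (m + k.+1%:Z)) w)
    = zeta (Y (m + k.+1%:Z) w).
  by rewrite /psi2 /random_vector mxE.
have psi1C : C_lLip psi1.
  apply: (@lipschitz_C_lLip _ _ _ k.+1%:R) => x y.
  apply: reflected_walk_lipschitz => j _; apply: le_trans (zeta_lip _ _) _.
  by have := coord_le_norm (x - y) (inord j); rewrite !mxE.
have psi2C : C_lLip psi2.
  apply: (@lipschitz_C_lLip _ _ _ 1) => x y; rewrite mul1r.
  apply: le_trans (zeta_lip _ _) _.
  by have := coord_le_norm (x - y) 0; rewrite !mxE.
have := @HYnd m k psi1 psi2 psi1C psi2C; cbv zeta.
have -> : psi1 \o random_vector (fun i : 'I_k.+1 => Y (m + (i : nat)%:Z))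
    = walk m k.+1 by apply/funext => w; exact: psi1E.
have -> : psi2 \o random_vector (fun=> Y (m + k.+1%:Z))
    = fun w => zeta (Y (m + k.+1%:Z) w) by apply/funext => w; exact: psi2E.
have HW := H_walk m k.+1; have HZ' := H_zeta (m + k.+1%:Z).
have wb w : `|walk m k.+1 w| <= k.+1%:R * c.
  by have /andP[w0 wc] := walk_bound m k.+1 w; rewrite ger0_norm.
rewrite /= zeta_mean mule0; apply.
- by move=> w; case/andP: (walk_bound m k.+1 w).
- by [].
- apply: le_lt_trans (E_le_cst HH HE _ (c := k.+1%:R * c * c) _) (ltry _).
    exact: H_mul.
  move=> w; apply: le_trans (ler_norm _) _; rewrite normrM.
  by apply: ler_pM.
- by apply: le_lt_trans (E_le_cst HH HE (H_abs HH HW) wb) (ltry _).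
- apply: le_lt_trans (E_le_cst HH HE (H_abs HH HZ') (c := c) _) (ltry _).
  by move=> w.
- case: zeta_mono => zm; [left|right]; split => x y xy.
  + by apply: le_reflected_walk => j _; exact: zm.
  + exact: zm.
  + by apply: le_reflected_walk => j _; exact: zm.
  + exact: zm.
Qed.

(** The square of the walk grows by at most the square of the increment and a cross
    term, and the cross term has nonpositive expectation. *)
Lemma E_reflected_walk_sqr m n : (E (fun w => walk m n w ^+ 2)%R <= (n%:R * v)%:E)%E.
Proof.
elim: n => [|n IH].
  rewrite /walk /=; under eq_fun do rewrite expr0n /=.
  by rewrite (sle_cst HE) mul0r.
set u := fun w => walk m n w ^+ 2 in IH.
pose z w := zeta (Y (m + n%:Z) w).
have HW := H_walk m n; have Hz : H z := H_zeta _.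
have Hu : H u by exact: H_sqr.
have HWz : H (fun w => 2 * (walk m n w * z w)) by apply: H_scale => //; exact: H_mul.
have Hz2 : H (fun w => z w ^+ 2) by exact: H_sqr.
apply: (E_le HE (Y := fun w => u w + (2 * (walk m n w * z w) + z w ^+ 2))).
- by apply: H_sqr => //; exact: H_walk.
- by apply: H_add => //; exact: H_add.
- by move=> w; exact: reflected_walk_sqr.
- rewrite -(natr1 n) mulrDl mul1r; apply: (E_leD HE Hu) => //; first exact: H_add.
  rewrite -[v]add0r; apply: (E_leD HE HWz Hz2); last exact: zeta_var.
  rewrite -[X in X%:E](mulr0 2); apply: (E_leZ HE) => //; first exact: H_mul.
  exact: E_walk_step_le0.
Qed.

End NegativeDependence.

(** * Two-sided series *)

Section TwoSidedSeries.
Variable R : realType.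
Implicit Types u y D : int -> R.

Lemma esum_int (u : int -> \bar R) : (forall i, (0 <= u i)%E) ->
  (\esum_(i in [set: int]) u i = \sum_(k <oo) (u (Posz k) + u (Negz k)))%E.
Proof.
move=> u0; rewrite (esumID (range Posz))// !setTI nneseriesD//.
have -> : ~` range Posz = range Negz.
  apply/seteqP; split => -[] k /=.
  - by case; exists k.
  - by move=> _; exists k.
  - by case.
  - by move=> _ [].
have half (e : nat -> int) : injective e ->
    (\esum_(i in range e) u i = \sum_(k <oo) u (e k))%E.
  move=> e_inj; rewrite esum_set_image//; last by move=> k l _ _ /e_inj.
  by apply: eq_eseriesl => k; rewrite in_setT.
by rewrite !half// => k l [].
Qed.

Lemma summable_int u : summable [set: int] (fun i => (u i)%:E) =
  (\sum_(k <oo) (`|u (Posz k)| + `|u (Negz k)|)%:E < +oo)%E :> Prop.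
Proof.
by rewrite /summable esum_int//; congr (is_true (_ < _)%E).
Qed.

Lemma bisum_cvg u : summable [set: int] (fun i => (u i)%:E) ->
  \sum_(0 <= k < N) (u (Posz k) + u (Negz k)) @[N --> \oo] --> bisum u.
Proof.
rewrite summable_int => su.
have cvg_half (v : nat -> R) : (forall k, `|v k| <= `|u (Posz k)| + `|u (Negz k)|) ->
    cvgn (series v).
  move=> vu; apply: normed_cvg; apply: nnseries_is_cvg => [k|]; first exact: normr_ge0.
  apply: le_lt_trans su; apply: lee_nneseries => [k _ _|k _].
    by rewrite lee_fin normr_ge0.
  by rewrite lee_fin vu.
under eq_fun do rewrite big_split /=.
apply: cvgD; apply: cvg_half => k; by rewrite ?lerDl ?lerDr.
Qed.

(** The partial sums of a moving average, bounded through the partial sums [D] of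
    the shifted sequences.  Exchanging the two sums is legitimate as soon as the
    right-hand side is finite, since then all the series converge absolutely. *)
Lemma moving_average_bound (a y D : int -> R) (n : nat) (B : R) :
  (forall i k, (k <= n)%N -> `|\sum_(1 <= j < k.+1) y (i + j%:Z)| <= D i) ->
  (\sum_(k <oo) (`|a (Posz k)| * D (Posz k) + `|a (Negz k)| * D (Negz k))%:E
     <= B%:E)%E ->
  (forall j, (1 <= j <= n)%N ->
     summable [set: int] (fun i => (a i * y (i + j%:Z))%:E)) /\
  (forall k, (k <= n)%N ->
     `|\sum_(1 <= j < k.+1) bisum (fun i => a i * y (i + j%:Z))| <= B).
Proof.
move=> yD aD.
have D0 i : 0 <= D i by apply: le_trans (yD i 0%N (leq0n n)).
have yD2 i j : (1 <= j <= n)%N -> `|y (i + j%:Z)| <= 2 * D i.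
  case: j => // j /andP[_ jn].
  have := yD i j.+1 jn; have := yD i j (ltnW jn).
  rewrite [in X in _ -> X -> _]big_nat_recr//=.
  set s := \sum_(1 <= _ < j.+1) _ => h1 h2.
  have -> : y (i + j.+1%:Z) = (s + y (i + j.+1%:Z)) - s by rewrite addrAC subrr add0r.
  by apply: le_trans (ler_normB _ _) _; lra.
have summ j : (1 <= j <= n)%N ->
    summable [set: int] (fun i => (a i * y (i + j%:Z))%:E).
  move=> jn; rewrite summable_int.
  apply: (@le_lt_trans _ _ (2%:E * B%:E)%E); last by rewrite -EFinM ltry.
  apply: le_trans (lee_wpmul2l _ aD); last by rewrite lee_fin.
  rewrite -nneseriesZl; last first.
    by move=> k _; rewrite lee_fin addr_ge0// mulr_ge0.
  apply: lee_nneseries => [k _ _|k _]; first by rewrite lee_fin addr_ge0.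
  rewrite -EFinM lee_fin !normrM mulrDr; apply: lerD.
    by rewrite mulrCA ler_wpM2l// yD2.
  by rewrite mulrCA ler_wpM2l// yD2.
split => // k kn.
have cvgS m : (m <= n)%N ->
  \sum_(1 <= j < m.+1) \sum_(0 <= l < N)
      (a (Posz l) * y (Posz l + j%:Z) + a (Negz l) * y (Negz l + j%:Z))
    @[N --> \oo] --> \sum_(1 <= j < m.+1) bisum (fun i => a i * y (i + j%:Z)).
  elim: m => [_|m IH mn].
    rewrite big_geq//; under eq_fun do rewrite big_geq//; exact: cvg_cst.
  rewrite big_nat_recr//=; under eq_fun do rewrite big_nat_recr//=.
  apply: cvgD; first exact: IH (ltnW mn).
  by apply: bisum_cvg; apply: summ; rewrite mn.
apply: (cvgr_to_le (cvg_norm (cvgS k kn))).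
apply: nearW => N; rewrite exchange_big /=.
apply: le_trans (ler_norm_sum _ _ _) _.
rewrite -lee_fin; apply: le_trans aD.
apply: le_trans (nneseries_lim_ge N _); last first.
  by move=> l _ _; rewrite lee_fin addr_ge0// mulr_ge0.
rewrite sumEFin lee_fin; apply: ler_sum => l _.
rewrite big_split /= -!mulr_sumr; apply: le_trans (ler_normD _ _) _.
by rewrite !normrM lerD// ler_wpM2l// yD.
Qed.

End TwoSidedSeries.

(** * Truncation *)

Section Truncation.
Variable R : realType.

Definition clip (b y : R) : R := Num.max (- b) (Num.min b y).

Lemma clip_cases b y : 0 < b ->
  [\/ y <= - b /\ clip b y = - b, - b <= y <= b /\ clip b y = y
    | b <= y /\ clip b y = b].
Proof.
move=> b0; rewrite /clip; case: (leP b y) => yb.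
  by apply: Or33; split=> //; rewrite max_r//; lra.
case: (leP (- b) y) => yb'; last by apply: Or31; split => //; exact: ltW.
by apply: Or32; rewrite ltW.
Qed.

Lemma clip_bound b y : 0 < b -> `|clip b y| <= b.
Proof.
move=> b0; rewrite ler_norml.
by case: (clip_cases y b0) => -[h ->]; lra.
Qed.

Lemma clip_homo b : {homo clip b : x y / x <= y}.
Proof.
by move=> x y xy; rewrite /clip ge_max !le_max lexx/= le_min !ge_min lexx xy/= !orbT.
Qed.

Lemma clip_nonexpansive b x y : 0 < b -> `|clip b x - clip b y| <= `|x - y|.
Proof.
move=> b0; have mono u v : u <= v -> `|clip b u - clip b v| <= `|u - v|.
  move=> uv; rewrite !ler0_norm ?subr_le0//; last exact: clip_homo.
  by case: (clip_cases u b0) => -[h ->]; case: (clip_cases v b0) => -[h' ->]; lra.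
by case/orP: (le_total x y) => h; [|rewrite distrC (distrC x)]; exact: mono.
Qed.

Lemma clip_sqr b y : 0 < b -> clip b y ^+ 2 <= b ^+ 2 * profile b y.
Proof.
move=> b0; have b20 : 0 < b ^+ 2 by rewrite exprn_gt0.
have cy : `|clip b y| <= `|y|.
  have := ler_norm y; have := ler_norm (- y); rewrite normrN => y1 y2.
  by case: (clip_cases y b0) => -[h ->] //; rewrite ?normrN gtr0_norm//; lra.
rewrite -ler_pdivrMl// le_min !ler_pdivrMl//; apply/andP; split.
  rewrite [b ^+ 2]expr2 mulrACA divff ?gt_eqF// mulr1.
  rewrite -(real_normK (num_real (clip b y))) expr2.
  by apply: ler_pM => //; rewrite ?clip_bound.
rewrite exprMn exprVn mulrCA divff ?gt_eqF// mulr1.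
by rewrite -(real_normK (num_real (clip b y))) -(real_normK (num_real y)) lerXn2r// nnegrE.
Qed.

Lemma excess_le b y : 0 < b -> `|y - clip b y| <= b * profile b y.
Proof.
move=> b0.
have big : b <= `|y| -> `|y| <= b * profile b y.
  move=> yb; rewrite -ler_pdivrMl// mulrC le_min lexx /=.
  rewrite -(real_normK (num_real (y / b))) normrM normfV (gtr0_norm b0).
  rewrite expr2 ler_peMl ?divr_ge0 ?(ltW b0)//.
  by rewrite ler_pdivlMr// mul1r.
case: (clip_cases y b0) => -[h ->].
- have ny : `|y| = - y by rewrite ler0_norm//; lra.
  rewrite opprK; apply: le_trans (big _); rewrite ny; last by lra.
  by rewrite ler0_norm; lra.
- by rewrite subrr normr0 mulr_ge0 ?profile_ge0// ltW.
- have ny : `|y| = y by rewrite ger0_norm//; lra.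
  apply: le_trans (big _); rewrite ny//.
  by rewrite ger0_norm; lra.
Qed.

(** The walk is fed with centered increments; undoing the centering costs at most
    [|mu|] at each of the [n] times. *)
Lemma tail_sum_le (x h e : nat -> R) (mu : R) (n k : nat) :
  (forall j, x j <= h j + e j) -> (forall j, 0 <= e j) -> (k <= n)%N ->
  \sum_(k <= j < n) x j <=
  reflected_walk (fun j => h j - mu) n + n%:R * `|mu| + \sum_(0 <= j < n) e j.
Proof.
move=> xhe e0 kn.
apply: (@le_trans _ _ (\sum_(k <= j < n) ((h j - mu) + (`|mu| + e j)))).
  by apply: ler_sum => j _; have := xhe j; have := ler_norm mu; lra.
rewrite big_split -addrA /=; apply: lerD; first exact: sum_le_reflected_walk.
apply: (@le_trans _ _ (\sum_(0 <= j < n) (`|mu| + e j))).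
  rewrite [leRHS](big_cat_nat (n := k))//= lerDr; apply: sumr_ge0 => j _.
  exact: addr_ge0.
by rewrite big_split /= sumr_const_nat subn0 mulr_natl.
Qed.

End Truncation.

(** * Partial sums of a block *)

Section Block.
Variables (R : realType) (d : measure_display) (T : measurableType d).
Variables (H : set (T -> R)) (E : (T -> R) -> \bar R).
Hypothesis HH : rv_space H.
Hypothesis HE : sublinear_expectation H E.
Variables (Y : int -> T -> R) (Y0 : T -> R).
Hypothesis HY : forall i, H (Y i).
Hypothesis HY0 : H Y0.
Hypothesis HYnd : neg_dep_biseq E Y.
Hypothesis HYid : forall i, identically_distributed E (Y i) Y0.
Hypothesis HYmean : forall i, E (Y i) = 0%E /\ E (fun w => - Y i w) = 0%E.

Variables (b s : R) (n : nat).
Hypothesis b0 : 0 < b.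
Hypothesis s01 : 0 <= s <= 1.
Hypothesis n0 : (0 < n)%N.
Hypothesis E_profile :
  forall i, (E (fun w => profile b (Y i w))%R <= (s / n%:R)%:E)%E.

Lemma H_profile i : H (fun w => profile b (Y i w)).
Proof.
by apply: (H_lipschitz HH (L := 2 * b^-1)) => // x y; exact: profile_lipschitz.
Qed.

Lemma sn_bounds : 0 <= s / n%:R <= 1.
Proof.
case/andP: s01 => s0 s1; have n1 : 0 < n%:R :> R by rewrite ltr0n.
rewrite divr_ge0//= ler_pdivrMr// mul1r; apply: le_trans s1 _.
by rewrite ler1n.
Qed.

(** The truncated variables, of either sign, are centered by their common mean;
    since the whole variables are centered, that mean is of the order of the
    expected excess. *)
Lemma E_centered_walk (h : R -> R) :
  (forall x y, `|h x - h y| <= `|x - y|) ->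
  {homo h : x y / x <= y} \/ {homo h : x y /~ x <= y} ->
  (forall x, `|h x| <= b) -> (forall x, h x ^+ 2 <= b ^+ 2 * profile b x) ->
  (forall i, (E (fun w => h (Y i w))%R <= (b * (s / n%:R))%:E)%E) ->
  (forall i, ((- (b * (s / n%:R)))%:E <= E (fun w => h (Y i w))%R)%E) ->
  exists mu : R, `|mu| <= b * (s / n%:R) /\ forall m : int,
    (E (fun w => reflected_walk (fun j : nat => h (Y (m + j%:Z) w) - mu)%R n ^+ 2)%R
       <= (4 * b ^+ 2 * s)%:E)%E.
Proof.
move=> hlip hmono hb hsqr Eh_le Eh_ge.
have [e0 e1] := andP sn_bounds; set e := s / n%:R in e0 e1 Eh_le Eh_ge *.
have Hh V : H V -> H (fun w => h (V w)).
  by apply: (H_lipschitz HH (L := 1)) => x y; rewrite mul1r.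
have fin V : H V -> E (fun w => h (V w)) \is a fin_num.
  by move=> HV; apply: (E_fin HH HE (Hh V HV) (c := b)) => w.
have hC : C_lLip h by apply: (@lipschitz_C_lLip _ _ _ 1) => x y; rewrite mul1r.
pose mu := fine (E (fun w => h (Y0 w))).
have muE i : E (fun w => h (Y i w)) = mu%:E.
  rewrite fineK; last exact: fin.
  by apply: (HYid hC); exact: fin.
have mu_le : `|mu| <= b * e.
  by rewrite ler_norml; have := Eh_le 0; have := Eh_ge 0;
    rewrite muE !lee_fin => -> ->.
have mub : `|mu| <= b by apply: le_trans mu_le _; rewrite ger_pMr.
exists mu; split => // m.
have nE : n%:R * (4 * b ^+ 2 * e) = 4 * b ^+ 2 * s.
  by rewrite mulrCA /e (mulrC n%:R) divfK// pnatr_eq0 -lt0n.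
rewrite -nE.
apply: (@E_reflected_walk_sqr _ _ _ H E HH HE Y HY HYnd
  (fun x => h x - mu) (b + b) (4 * b ^+ 2 * e)).
- by move=> x y; rewrite opprB addrA subrK.
- by case: hmono => hm; [left|right] => x y xy; rewrite lerD2r; exact: hm.
- by move=> x; apply: le_trans (ler_normB _ _) _; exact: lerD.
- by move=> i; apply: (E_centered HH HE) (muE i); exact: Hh.
- move=> i; set Z := fun w => 2 * b ^+ 2 * profile b (Y i w).
  have HZ' : H Z by apply: H_scale => //; exact: H_profile.
  have Hc : H (cst (2 * b ^+ 2 * e)) := H_cst HH _ HY0.
  apply: (E_le HE (Y := fun w => Z w + cst (2 * b ^+ 2 * e) w)).
  + by apply: (H_sqr HH); apply: (H_sub HH); [exact: Hh|exact: (H_cst HH _ HY0)].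
  + exact: H_add.
  + move=> w; rewrite /Z /=.
    have mu2 : mu ^+ 2 <= b ^+ 2 * e.
      apply: (@le_trans _ _ ((b * e) ^+ 2)).
        have be0 : 0 <= b * e by rewrite mulr_ge0// ltW.
        by rewrite -(real_normK (num_real mu)) lerXn2r// nnegrE.
      rewrite exprMn ler_pM2l ?exprn_gt0// expr2.
      exact: ler_piMl.
    have := hsqr (Y i w); have := sqr_ge0 (h (Y i w) + mu).
    move: mu2; rewrite sqrrB sqrrD; lra.
  + have -> : 4 * b ^+ 2 * e = 2 * b ^+ 2 * e + 2 * b ^+ 2 * e by lra.
    apply: (E_leD HE) => //; last by rewrite (sle_cst HE).
    apply: (E_leZ HE) => //; first exact: H_profile.
    by rewrite mulr_ge0// sqr_ge0.
Qed.

(** A centered variable and its truncation differ by at most [b * profile b].  The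
    boolean [sg] selects the sign: a sublinear expectation treats a variable and its
    opposite separately. *)
Lemma E_clip_bounds (sg : bool) i :
  ((- (b * (s / n%:R)))%:E <= E (fun w => (-1) ^+ sg * clip b (Y i w))%R
     <= (b * (s / n%:R))%:E)%E.
Proof.
have Hclip : H (fun w => clip b (Y i w)).
  by apply: (H_lipschitz HH (L := 1)) => // x y; rewrite mul1r clip_nonexpansive.
have HX : H (fun w => (-1) ^+ sg * clip b (Y i w)) by exact: H_scale.
have HYs : H (fun w => (-1) ^+ sg * Y i w) by exact: H_scale.
have HP : H (fun w => b * profile b (Y i w)) by apply: H_scale => //; exact: H_profile.
have EP : (E (fun w => b * profile b (Y i w))%R <= (b * (s / n%:R))%:E)%E.
  by apply: (E_leZ HE) => //; [exact: H_profile|exact: ltW].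
have EYs : E (fun w => (-1) ^+ sg * Y i w) = 0%E.
  case: sg {HX HYs}; rewrite /= ?expr0 ?expr1.
    by under eq_fun do rewrite mulN1r; case: (HYmean i).
  by under eq_fun do rewrite mul1r; case: (HYmean i).
have ex w : `|(-1) ^+ sg * Y i w - (-1) ^+ sg * clip b (Y i w)|
    <= b * profile b (Y i w).
  by rewrite -mulrBr normrM normr_sign mul1r excess_le.
apply/andP; split.
  have : (E (fun w => (-1) ^+ sg * Y i w)%R <=
      E (fun w => (-1) ^+ sg * clip b (Y i w) + b * profile b (Y i w))%R)%E.
    apply: (sle_mono HE) => //; first exact: H_add.
    by move=> w; have := ler_norm ((-1) ^+ sg * Y i w - (-1) ^+ sg * clip b (Y i w));
      have := ex w; lra.
  rewrite EYs => E0.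
  rewrite leNgt; apply/negP => lt0.
  have [r Er] : exists2 r : R, r < - (b * (s / n%:R)) &
      (E (fun w => (-1) ^+ sg * clip b (Y i w))%R <= r%:E)%E.
    case: (E _) lt0 => [r||]//; first by rewrite lte_fin => r0; exists r.
    move=> _; exists (- (b * (s / n%:R)) - 1); rewrite ?leNye//; lra.
  move=> Ele; have := le_trans E0 (E_leD HE HX HP Ele EP).
  by rewrite lee_fin; lra.
apply: (E_le HE (Y := fun w => (-1) ^+ sg * Y i w + b * profile b (Y i w))) => //.
- exact: H_add.
- move=> w; have := lerNnormlW (lexx `|(-1) ^+ sg * Y i w - (-1) ^+ sg * clip b (Y i w)|).
  by have := ex w; lra.
- by rewrite -[X in X%:E]add0r; apply: (E_leD HE HYs HP) => //; rewrite EYs.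
Qed.

(** The sum of the first [k] terms is the difference of two sums ending at time [n],
    so that it is controlled by the reflected walks of both signs.  These enter
    through their squares, the only quantities with a known expectation: the
    parameter [eta] is the price of replacing a walk by its square. *)
Lemma block_bound (eta : R) : 0 < eta ->
  exists W : int -> T -> R,
    [/\ forall i, H (W i), forall i w, 0 <= W i w,
        forall i, (E (W i) <= (2 * s / eta + 2 * s)%:E)%E &
        forall i w k, (k <= n)%N ->
          `|\sum_(1 <= j < k.+1) Y (i + j%:Z) w| <= b * (2 * eta + 2 * s + W i w)].
Proof.
move=> eta0; have [s0 s1] := andP s01.
have walk (sg : bool) : exists mu : R, `|mu| <= b * (s / n%:R) /\ forall m : int,
    (E (fun w => reflected_walk
          (fun j : nat => (-1) ^+ sg * clip b (Y (m + j%:Z) w) - mu)%R n ^+ 2)%R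
       <= (4 * b ^+ 2 * s)%:E)%E.
  apply: (@E_centered_walk (fun x => (-1) ^+ sg * clip b x)).
  - by move=> x y; rewrite -mulrBr normrM normr_sign mul1r clip_nonexpansive.
  - case: sg; [right|left] => x y /(clip_homo b).
      by rewrite expr1 !mulN1r lerN2.
    by rewrite expr0 !mul1r.
  - by move=> x; rewrite normrM normr_sign mul1r clip_bound.
  - by move=> x; rewrite exprMn sqrr_sign mul1r clip_sqr.
  - by move=> i; case/andP: (E_clip_bounds sg i).
  - by move=> i; case/andP: (E_clip_bounds sg i).
have [mu [mub muE]] := walk false; have [nu [nub nuE]] := walk true.
rewrite {walk}.
(* Translate number [i] starts at time [i + 1]. *)
pose A i w := reflected_walk
  (fun j : nat => (-1) ^+ false * clip b (Y (i + 1 + j%:Z) w) - mu) n.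
pose B i w := reflected_walk
  (fun j : nat => (-1) ^+ true * clip b (Y (i + 1 + j%:Z) w) - nu) n.
pose X i w := \sum_(0 <= j < n) b * profile b (Y (i + 1 + j%:Z) w).
have Hwalk (sg : bool) (c : R) i : H (fun w => reflected_walk
    (fun j : nat => (-1) ^+ sg * clip b (Y (i + 1 + j%:Z) w) - c) n).
  elim: (n) => [|k IH] /=; first exact: (H_cst HH 0 HY0).
  apply: (H_max HH (H_cst HH 0 HY0)); apply: H_add => //; apply: H_sub => //.
    apply: H_scale => //; apply: (H_lipschitz HH (L := 1)) => // x y.
    by rewrite mul1r clip_nonexpansive.
  exact: (H_cst HH _ HY0).
have HXj i (j : nat) : H (fun w => b * profile b (Y (i + 1 + j%:Z) w)).
  by apply: H_scale => //; exact: H_profile.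
have HX i : H (X i) by apply: (H_sum HH HY0).
pose c := (4 * eta * b ^+ 2)^-1.
have c0 : 0 < c by rewrite invr_gt0 mulr_gt0// ?exprn_gt0// mulr_gt0.
exists (fun i w => c * (A i w ^+ 2 + B i w ^+ 2) + 2 / b * X i w).
have HAB i : H (fun w => A i w ^+ 2 + B i w ^+ 2).
  by apply: (H_add HH); apply: (H_sqr HH); exact: Hwalk.
have A0 i w : 0 <= A i w by exact: reflected_walk_ge0.
have B0 i w : 0 <= B i w by exact: reflected_walk_ge0.
have X0 i w : 0 <= X i w.
  by apply: sumr_ge0 => j _; rewrite mulr_ge0 ?(ltW b0)// profile_ge0.
split.
- by move=> i; apply: (H_add HH); apply: (H_scale HH).
- by move=> i w; rewrite addr_ge0 ?mulr_ge0 ?addr_ge0 ?sqr_ge0 ?(ltW c0) ?invr_ge0 ?(ltW b0).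
- move=> i; have -> : 2 * s / eta = c * (4 * b ^+ 2 * s + 4 * b ^+ 2 * s).
    by rewrite /c; field; rewrite !gt_eqF.
  have -> : 2 * s = 2 / b * (n%:R * (b * (s / n%:R))).
    by field; rewrite pnatr_eq0 -lt0n n0 gt_eqF.
  apply: (E_leD HE); first exact: H_scale.
  + exact: H_scale.
  + apply: (E_leZ HE) => //; first exact: ltW.
    by apply: (E_leD HE); [apply: H_sqr|apply: H_sqr|exact: muE|exact: nuE] => //;
      exact: Hwalk.
  + apply: (E_leZ HE) => //; first by rewrite divr_ge0// ltW.
    have := @E_sum_le _ _ _ H E HH HE Y0 _ (index_iota 0 n)
      (fun (j : nat) w => b * profile b (Y (i + 1 + j%:Z) w)) (b * (s / n%:R)) HY0.
    rewrite size_iota subn0; apply=> [j|j]; first exact: HXj.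
    by apply: (E_leZ HE); [exact: H_profile|exact: ltW|].
move=> i w k kn.
have tail (sg : bool) (m : R) l : `|m| <= b * (s / n%:R) -> (l <= n)%N ->
    \sum_(l <= j < n) (-1) ^+ sg * Y (i + 1 + j%:Z) w <=
    reflected_walk (fun j : nat => (-1) ^+ sg * clip b (Y (i + 1 + j%:Z) w) - m) n
    + b * s + X i w.
  move=> mb ln; apply: le_trans (tail_sum_le (x := fun j : nat => (-1) ^+ sg * Y (i + 1 + j%:Z) w)
    (h := fun j : nat => (-1) ^+ sg * clip b (Y (i + 1 + j%:Z) w))
    (e := fun j : nat => b * profile b (Y (i + 1 + j%:Z) w)) m _ _ ln) _.
  - move=> j; rewrite -lerBlDl -mulrBr; apply: le_trans (ler_norm _) _.
    by rewrite normrM normr_sign mul1r excess_le.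
  - by move=> j; rewrite mulr_ge0 ?(ltW b0)// profile_ge0.
  - rewrite lerD2r lerD2l -(@ler_pM2l _ n%:R^-1) ?invr_gt0 ?ltr0n//.
    rewrite mulrA mulVf ?pnatr_eq0 -?lt0n// mul1r; apply: le_trans mb _.
    by rewrite (mulrC n%:R^-1) mulrA.
have splitS : \sum_(1 <= j < k.+1) Y (i + j%:Z) w =
    \sum_(0 <= j < n) Y (i + 1 + j%:Z) w - \sum_(k <= j < n) Y (i + 1 + j%:Z) w.
  rewrite [X in _ = X - _](big_cat_nat (n := k))//= addrK big_add1 /=.
  by apply: eq_bigr => j _; rewrite intS addrA.
have p1 := tail false mu 0%N mub (leq0n n); have p2 := tail false mu k mub kn.
have q1 := tail true nu 0%N nub (leq0n n); have q2 := tail true nu k nub kn.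
move: p1 p2 q1 q2; rewrite -!mulr_sumr -/(A i w) -/(B i w) expr0 expr1 !mul1r !mulN1r.
rewrite splitS.
(* The constant [c] is the one for which the difference is a perfect square. *)
have amgm r : r <= b * eta + b * (c * r ^+ 2).
  have -> : b * eta + b * (c * r ^+ 2) =
      r + (b * eta - r / 2) ^+ 2 / (b * eta).
    by rewrite /c; field; rewrite !gt_eqF.
  by rewrite lerDl divr_ge0 ?sqr_ge0// mulr_ge0// ltW.
have := amgm (A i w); have := amgm (B i w).
have -> : b * (2 * eta + 2 * s + (c * (A i w ^+ 2 + B i w ^+ 2) + 2 / b * X i w)) =
  b * eta + b * (c * A i w ^+ 2) + (b * eta + b * (c * B i w ^+ 2))
   + 2 * (b * s) + 2 * X i w by field; rewrite gt_eqF.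
set S0 := \sum_(0 <= j < n) _; set Sk := \sum_(k <= j < n) _.
by move=> *; rewrite ler_norml; apply/andP; split; lra.
Qed.

End Block.

(** * Partial sums of the moving average *)

Section CapacityBound.
Variables (R : realType) (d : measure_display) (T : measurableType d).
Variables (H : set (T -> R)) (E : (T -> R) -> \bar R).
Hypothesis HH : rv_space H.
Hypothesis HE : sublinear_expectation H E.
Hypothesis HEc : countably_subadditive H E.
Variables (a : int -> R) (Y : int -> T -> R) (X : nat -> T -> R).
Hypothesis HX : moving_average H a Y X.

(** The variable [xi] is at least [1] on the event and belongs to the space, as the
    process does; wherever the sum of the [Xs] is finite, the series that define the
    process converge absolutely and [xi] is below that sum. *)
Lemma moving_average_capacity (W : int -> T -> R) (A b C eps v : R) (n : nat) :
  (\sum_(k <oo) (`|a (Posz k)| + `|a (Negz k)|)%:E <= A%:E)%E ->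
  0 < b -> 0 <= C -> 0 < eps -> C * A <= eps / 2 -> 0 <= v ->
  (forall i, H (W i)) -> (forall i w, 0 <= W i w) ->
  (forall i, (E (W i) <= v%:E)%E) ->
  (forall i w k, (k <= n)%N ->
     `|\sum_(1 <= j < k.+1) Y (i + j%:Z) w| <= b * (C + W i w)) ->
  (capacity H E [set w | (eps * b <
      \big[Num.max/0]_(1 <= k < n.+1) `|\sum_(1 <= j < k.+1) X j w|)%R]
    <= (2 / eps * (v * A))%:E)%E.
Proof.
move=> aA b0 C0 eps0 CA v0 HW W0 EW YW.
pose M w := \big[Num.max/0]_(1 <= k < n.+1) `|\sum_(1 <= j < k.+1) X j w|.
pose xi w := 2 / eps * Num.max 0 (b^-1 * M w - eps / 2).
pose Xs (k : nat) w := 2 / eps *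
  (`|a (Posz k)| * W (Posz k) w + `|a (Negz k)| * W (Negz k) w).
have e0 : 0 <= 2 / eps by rewrite divr_ge0// ltW.
have HXn j : (1 <= j)%N -> H (X j) by move=> /HX[].
have HW0 := HW 0.
have H_M : H M.
  apply: (H_bigmax HH _ HW0) => k; apply: (H_abs HH).
  apply: (H_sum HH HW0) => j; rewrite mem_index_iota => /andP[j1 _].
  exact: HXn.
have Hxi : H xi.
  apply: (H_scale HH); apply: (H_max HH (H_cst HH 0 HW0)).
  by apply: (H_sub HH); [exact: H_scale|exact: (H_cst HH _ HW0)].
have HXs k : H (Xs k) by apply: (H_scale HH); apply: (H_add HH); apply: (H_scale HH).
have Xs0 k w : 0 <= Xs k w by rewrite mulr_ge0// addr_ge0// mulr_ge0.
have cover w : ((xi w)%:E <= \sum_(k <oo) (Xs k w)%:E)%E.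
  have [->|] := eqVneq (\sum_(k <oo) (Xs k w)%:E)%E +oo%E; first exact: leey.
  pose Z := (\sum_(k <oo)
    (`|a (Posz k)| * W (Posz k) w + `|a (Negz k)| * W (Negz k) w)%:E)%E.
  have Z0 k : (0 <= (`|a (Posz k)| * W (Posz k) w + `|a (Negz k)| * W (Negz k) w)%:E)%E.
    by rewrite lee_fin addr_ge0// mulr_ge0.
  have XsZ : (\sum_(k <oo) (Xs k w)%:E = (2 / eps)%:E * Z)%E.
    by rewrite -nneseriesZl//; apply: eq_eseriesr => k _; rewrite -EFinM.
  rewrite XsZ => Zoo.
  have Zfin : Z \is a fin_num.
    rewrite ge0_fin_numE; last by apply: nneseries_ge0 => k _ _.
    rewrite ltey; apply: contra_neq Zoo => ->.
    by rewrite gt0_muley// lte_fin divr_gt0.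
  rewrite -(fineK Zfin) -EFinM lee_fin ler_pM2l ?divr_gt0//.
  have r0 : 0 <= fine Z by apply: fine_ge0; apply: nneseries_ge0.
  set r := fine Z in r0 *.
  have bnd : (\sum_(k <oo) (`|a (Posz k)| * (b * (C + W (Posz k) w)) +
      `|a (Negz k)| * (b * (C + W (Negz k) w)))%:E <= (b * (C * A + r))%:E)%E.
    rewrite [leRHS]EFinM EFinD EFinM (fineK Zfin).
    apply: (@le_trans _ _ (b%:E * (C%:E * \sum_(k <oo)
       (`|a (Posz k)| + `|a (Negz k)|)%:E + Z))%E); last first.
      apply: lee_wpmul2l; first by rewrite lee_fin ltW.
      by apply: leeD => //; apply: lee_wpmul2l.
    rewrite -nneseriesZl; last by move=> k _; rewrite lee_fin addr_ge0.
    rewrite -nneseriesD//; last first.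
      by move=> k _ _; rewrite -EFinM lee_fin mulr_ge0// addr_ge0.
    rewrite -nneseriesZl; last first.
      by move=> k _; rewrite adde_ge0// -EFinM lee_fin mulr_ge0// addr_ge0.
    rewrite le_eqVlt; apply/orP; left; apply/eqP.
    have distr (u u' x x' : R) : u * (b * (C + x)) + u' * (b * (C + x')) =
        b * (C * (u + u') + (u * x + u' * x')) by ring.
    by apply: eq_eseriesr => k _; exact: (congr1 EFin (distr _ _ _ _)).
  have [summ sums] := moving_average_bound (a := a) (y := fun i => Y i w)
    (D := fun i => b * (C + W i w)) (fun i => YW i w) bnd.
  rewrite ge_max r0 /= lerBlDr ler_pdivrMl//.
  have Cr0 : 0 <= b * (r + eps / 2) by rewrite mulr_ge0 ?(ltW b0)// addr_ge0// divr_ge0// ltW.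
  rewrite /M big_seq; apply: bigmax_le => // k; rewrite mem_index_iota ltnS => /andP[_ kn].
  have := sums k kn.
  have -> : \sum_(1 <= j < k.+1) bisum (fun i => a i * Y (i + j%:Z) w) =
      \sum_(1 <= j < k.+1) X j w.
    apply: eq_big_nat => j /andP[j1 jk]; have [_ ->//] := HX j1.
    by apply: summ; rewrite j1/= (leq_trans _ kn).
  move/le_trans; apply; rewrite ler_pM2l//; lra.
apply: (@le_trans _ _ (E xi)).
  apply: capacity_le => // w; rewrite indicE.
  have xi0 : 0 <= xi w by rewrite mulr_ge0// le_max lexx.
  have [|_ //] := boolP (w \in _); rewrite inE /= -/(M w) => Mw.
  rewrite /xi mulrC -ler_pdivrMr ?divr_gt0// mul1r invf_div le_max.
  apply/orP; right; rewrite lerBrDr -splitr mulrC ler_pdivlMr//; exact: ltW.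
apply: le_trans (HEc Hxi HXs _ Xs0 cover) _.
  by move=> w; rewrite mulr_ge0// le_max lexx.
apply: (@le_trans _ _ (\sum_(k <oo) ((2 / eps * v)%:E *
    (`|a (Posz k)| + `|a (Negz k)|)%:E))%E).
  apply: lee_nneseries => [k _ _|k _]; first exact: (E_ge0 HH HE).
  rewrite /Xs -EFinM -(mulrA (2 / eps)); apply: (E_leZ HE) => //.
    by apply: (H_add HH); apply: (H_scale HH).
  rewrite mulrDr; apply: (E_leD HE); try exact: (H_scale HH).
    by rewrite [v * _]mulrC; apply: (E_leZ HE).
  by rewrite mulrC; apply: (E_leZ HE).
rewrite nneseriesZl; last by move=> k _; rewrite lee_fin addr_ge0.
apply: (@le_trans _ _ ((2 / eps * v)%:E * A%:E)%E).
  by apply: lee_wpmul2l; rewrite // lee_fin mulr_ge0.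
by rewrite -EFinM mulrA.
Qed.

End CapacityBound.

(** * The convergence theorem *)

Theorem theorem3p2 (R : realType) (d : measure_display) (T : measurableType d)
    (H : set (T -> R)) (E : (T -> R) -> \bar R)
    (HH : rv_space H) (HE : sublinear_expectation H E)
    (HEc : countably_subadditive H E)
    (l : R -> R) (Hl : slowly_varying l)
    (a : int -> R) (Ha : summable [set: int] (fun i => (a i)%:E))
    (Y : int -> T -> R) (Y0 : T -> R)
    (HY : forall i, H (Y i)) (HY0 : H Y0)
    (HYnd : neg_dep_biseq E Y)
    (HYid : forall i, identically_distributed E (Y i) Y0)
    (HYmean : forall i, E (Y i) = 0%E /\ E (fun w => - Y i w) = 0%E)
    (X : nat -> T -> R) (HX : moving_average H a Y X)
    (g f : nat -> R)
    (Hg : forall n, (1 <= n)%N -> 0 < g n)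
    (Hf : forall n, (1 <= n)%N -> 0 < f n)
    (Hfmono : forall m n, (1 <= m)%N -> (m <= n)%N -> f m <= f n)
    (Hfoo : f n @[n --> \oo] --> +oo)
    (Psi : nat -> R -> R)
    (HPsi_even : forall n, (1 <= n)%N -> forall t, Psi n (- t) = Psi n t)
    (HPsi_ge0 : forall n, (1 <= n)%N -> forall t, 0 <= Psi n t)
    (HPsi_gt0 : forall n, (1 <= n)%N -> forall t, 0 < t -> 0 < Psi n t)
    (p q : R) (Hp : 1 <= p) (Hpq : p < q) (Hq : q < 2)
    (HPsi_p : forall n, (1 <= n)%N -> forall s t : R,
      0 < `|s| -> `|s| <= `|t| ->
      Psi n s / `|s| `^ p <= Psi n t / `|t| `^ p)
    (HPsi_q : forall n, (1 <= n)%N -> forall s t : R,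
      0 < `|s| -> `|s| <= `|t| ->
      Psi n t / `|t| `^ q <= Psi n s / `|s| `^ q)
    (Hsum : forall j : nat,
      (\sum_(1 <= n <oo) ((g n * l n%:R)%R%:E *
         \sum_(j.+1 <= i < (j + n).+1)
           (choquet (capacity H E) (Psi i \o Y i%:Z)
            * ((Psi i (f n))^-1)%R%:E)) < +oo)%E)
    (Hlim : forall j : nat,
      (\sum_(j.+1 <= i < (j + n).+1)
           (choquet (capacity H E) (Psi i \o Y i%:Z)
            * ((Psi i (f n))^-1)%R%:E))%E @[n --> \oo] --> 0%E) :
  forall eps : R, 0 < eps ->
    (\sum_(1 <= n <oo) ((g n * l n%:R)%R%:E *
       capacity H E [set w | (eps * f n <
         \big[Num.max/0]_(1 <= k < n.+1) `|\sum_(1 <= j < k.+1) X j w|)%R])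
     < +oo)%E.
Proof.
move=> eps eps0.
pose S n := (\sum_(1 <= m < n.+1)
  (choquet (capacity H E) (Psi m \o Y m%:Z) * ((Psi m (f n))^-1)%:E))%E.
have S_lim : S n @[n --> \oo] --> 0%E := Hlim 0%N.
have S_sum : (\sum_(1 <= n <oo) ((g n * l n%:R)%:E * S n) < +oo)%E := Hsum 0%N.
have q2 : q <= 2 by exact: ltW.
have S_ge0 n : (0 <= S n)%E.
  rewrite /S big_seq; apply: sume_ge0 => m; rewrite mem_index_iota => /andP[m1 _].
  exact: (choquet_ratio_ge0 HH HE Y HY0 HPsi_ge0).
have gl_ge0 n : (1 <= n)%N -> 0 <= g n * l n%:R.
  by move=> n1; rewrite mulr_ge0// ltW ?Hg//; case: Hl => l0 _ _; exact: l0.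
move: (Ha); rewrite summable_int; set a1 := (\sum_(k <oo) _)%E => a1oo.
have a1_ge0 : (0 <= a1)%E.
  by apply: nneseries_ge0 => k _ _; rewrite lee_fin addr_ge0.
pose A := fine a1.
have aA : a1 = A%:E by rewrite fineK// ge0_fin_numE.
have A0 : 0 <= A by exact: fine_ge0.
(* With [s <= eta], the deterministic part [(2 * eta + 2 * s) * A] is at most
   [4 * eta * A <= eps / 2]. *)
pose eta := eps / (8 * (A + 1)).
have eta0 : 0 < eta by rewrite divr_gt0// mulr_gt0// ltr_wpDl.
have etaA : 4 * eta * A <= eps / 2.
  have -> : 4 * eta * A = eps / 2 * (A / (A + 1)).
    by rewrite /eta; field; rewrite gt_eqF// ltr_wpDl.
  by rewrite ger_pMr ?divr_gt0// ler_pdivrMr ?ltr_wpDl// mul1r lerDl.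
have [N S_small] : exists N, forall n, (N <= n)%N ->
    S n \is a fin_num /\ fine (S n) < Num.min 1 eta.
  have /fine_cvgP[S_fin S_cvg] := S_lim.
  have m0 : 0 < Num.min 1 eta by rewrite lt_min ltr01.
  have [N _ NS] := filterI S_fin (cvgr_lt _ S_cvg _ m0).
  by exists N => n /NS.
pose K := 2 / eps * ((2 / eta + 2) * A).
have K0 : 0 <= K.
  by rewrite mulr_ge0 ?divr_ge0 ?(ltW eps0)// mulr_ge0// addr_ge0// divr_ge0// ltW.
have V_le n : (1 <= n)%N -> (N <= n)%N ->
    (capacity H E [set w | (eps * f n <
       \big[Num.max/0]_(1 <= k < n.+1) `|\sum_(1 <= j < k.+1) X j w|)%R]
     <= K%:E * S n)%E.
  move=> n1 Nn; have [Sfin] := S_small n Nn.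
  rewrite lt_min => /andP[/ltW s1 /ltW s_eta].
  have s0 : 0 <= fine (S n) by exact: fine_ge0.
  have SE := fineK Sfin; set s := fine (S n) in s1 s_eta s0 SE.
  have fn0 := Hf n n1.
  have E_prof i : (E (fun w => profile (f n) (Y i w))%R <= (s / n%:R)%:E)%E.
    apply: (E_profile_le HH HE HEc HY HY0 HYid HPsi_ge0 HPsi_gt0 Hp q2
      HPsi_p HPsi_q) => //.
    by rewrite SE.
  have s01 : 0 <= s <= 1 by rewrite s0.
  have [W [HW W0 EW YW]] := block_bound HH HE HY HY0 HYnd HYid HYmean fn0 s01 n1
    E_prof eta0.
  rewrite -SE -EFinM.
  have -> : K * s = 2 / eps * ((2 * s / eta + 2 * s) * A).
    by rewrite /K; field; rewrite !gt_eqF.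
  apply: (moving_average_capacity HH HE HEc HX _ fn0 _ eps0 _ _ HW W0 EW YW).
  - by rewrite -/a1 aA.
  - by rewrite addr_ge0// mulr_ge0// ltW.
  - by apply: le_trans etaA; rewrite ler_wpM2r//; lra.
  - by rewrite addr_ge0 ?mulr_ge0 ?invr_ge0 ?(ltW eta0).
have term_ge0 n : (1 <= n)%N -> (0 <= (g n * l n%:R)%:E * S n)%E.
  by move=> n1; rewrite mule_ge0// lee_fin gl_ge0.
(* The terms of index at most [N] contribute a finite sum. *)
rewrite (@nneseries_split _ _ 1 N); last first.
  by move=> n n1; rewrite mule_ge0 ?(capacity_ge0 HH HE)// lee_fin gl_ge0.
apply: lte_add_pinfty.
  apply: le_lt_trans (ltry (\sum_(1 <= n < 1 + N) g n * l n%:R)).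
  rewrite -sumEFin big_seq [leRHS]big_seq; apply: lee_sum => n.
  rewrite mem_index_iota => /andP[n1 _]; rewrite -[leRHS]mule1.
  by apply: lee_wpmul2l; rewrite ?lee_fin ?gl_ge0// (capacity_le1 HH HE _ HY0).
rewrite eseries_cond.
apply: (@le_lt_trans _ _ (K%:E * \sum_(1 + N <= n <oo) ((g n * l n%:R)%:E * S n))%E).
  rewrite [X in (_ * X)%E]eseries_cond -nneseriesZl; last first.
    by move=> n /andP[_ n1]; apply: term_ge0; apply: leq_trans n1.
  apply: lee_nneseries => n.
    move=> _ /andP[_ n1]; rewrite mule_ge0 ?(capacity_ge0 HH HE)// lee_fin gl_ge0//.
    exact: leq_trans n1.
  move=> /andP[_ n1]; have n1' : (1 <= n)%N by exact: leq_trans n1.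
  rewrite muleCA; apply: lee_wpmul2l; first by rewrite lee_fin gl_ge0.
  by apply: V_le => //; apply: leq_trans n1.
apply: lte_mul_pinfty => //.
apply: le_lt_trans S_sum; rewrite [leRHS](@nneseries_split _ _ 1 N)//.
rewrite leeDr// big_seq; apply: sume_ge0 => n; rewrite mem_index_iota => /andP[n1 _].
exact: term_ge0.
Qed.
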